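(* Let $\Lambda$ be a row-finite $k$-graph with no sources and let $K$ be a field. Then $\mathrm{KP}_K(\Lambda)$ is semisimple if and only if $\mathrm{KP}_K(\Lambda)\cong\bigoplus_{[v]\in P_l(\Lambda)/\sim}M_\infty(K)$ (as $K$-algebras).
   Context: $\mathbb N=\{0,1,2,\dots\}$; $k$ is a positive integer; $\mathbb N^k$ is ordered coordinatewise. A $k$-graph is a countable category $\Lambda$ with object set $\Lambda^0$ and range and source maps $r,s$, with a functor $d:\Lambda\to\mathbb N^k$ ($\mathbb N^k$ viewed as a one-object category) such that whenever $d(\lambda)=m+n$ there are unique $\mu,\nu\in\Lambda$ with $s(\mu)=r(\nu)$, $d(\mu)=m$, $d(\nu)=n$, $\lambda=\mu\nu$. Morphisms are called paths; objects (vertices) are identified with the paths of degree $0$. $\Lambda^n=d^{-1}(n)$, $\Lambda^{\neq 0}=\Lambda\setminus\Lambda^0$, $v\Lambda=\{\lambda: r(\lambda)=v\}$, $v\Lambda^n=v\Lambda\cap\Lambda^n$. $\Lambda$ is row-finite with no sources if $0<|v\Lambda^n|<\infty$ for all $v\in\Lambda^0$, $n\in\mathbb N^k$. Infinite paths: $\Omega_k$ is the $k$-graph with objects $\mathbb N^k$, morphisms $(m,n)$ with $m\le n$, $r(m,n)=m$, $s(m,n)=n$, $(m,n)(n,p)=(m,p)$, $d(m,n)=n-m$. $\Lambda^\infty$ is the set of degree-preserving functors $x:\Omega_k\to\Lambda$; $x(m):=x(m,m)$; $v\Lambda^\infty=\{x\in\Lambda^\infty:x(0)=v\}$. For $p\in\mathbb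 N^k$, $\sigma^p(x)(m,n)=x(m+p,n+p)$. $x$ is periodic if $\sigma^p(x)=\sigma^q(x)$ for some $p\ne q$ in $\mathbb N^k$, and aperiodic otherwise. A vertex $v$ is a line point if $v\Lambda^\infty=\{x\}$ is a singleton and $x$ is aperiodic; $P_l(\Lambda)$ is the set of line points. For $v,w\in P_l(\Lambda)$ with $v\Lambda^\infty=\{x\}$, $w\Lambda^\infty=\{y\}$, write $v\sim w$ if there exist $m,n\in\mathbb N^k$ with $x(m)=y(n)$; this is an equivalence relation on $P_l(\Lambda)$. Kumjian-Pask algebra: $\mathrm{KP}_K(\Lambda)$ is the universal $K$-algebra generated by elements $p_v$ ($v\in\Lambda^0$), $s_\lambda$, $s_{\lambda^*}$ ($\lambda\in\Lambda^{\ne0}$) subject to: (KP1) the $p_v$ are mutually orthogonal idempotents; (KP2) for $\lambda,\mu\in\Lambda^{\neq0}$ with $r(\mu)=s(\lambda)$: $s_\lambda s_\mu=s_{\lambda\mu}$, $s_{\mu^*}s_{\lambda^*}=s_{(\lambda\mu)^*}$, $p_{r(\lambda)}s_\lambda=s_\lambda=s_\lambda p_{s(\lambda)}$, $p_{s(\lambda)}s_{\lambda^*}=s_{\lambda^*}=s_{\lambda^*}p_{r(\lambda)}$; (KP3) $s_{\lambda^*}s_\mu=\delta_{\lambda,\mu}p_{s(\lambda)}$ if $d(\lambda)=d(\mu)$; (KP4) $p_v=\sum_{\lambda\in v\Lambda^n}s_\lambda s_{\lambda^*}$ for all $v\in\Lambda^0$, $n\in\mathbb N^k\setminus\{0\}$.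 (The algebra need not be unital.) The socle $\mathrm{Soc}(R)$ of a semiprime ring $R$ is the sum of all its minimal left-ideals; a semiprime ring $R$ is semisimple if $\mathrm{Soc}(R)=R$. $\mathrm{KP}_K(\Lambda)$ is semiprime. $M_\infty(K)$ is the algebra of matrices indexed by $\mathbb N\times\mathbb N$ over $K$ with only finitely many nonzero entries. *)

(* Defs.v *)
From HB Require Import structures.
From mathcomp Require Import all_boot all_order all_algebra.
From mathcomp Require Import generic_quotient.
From mathcomp Require Import mathcomp_extra boolp classical_sets functions.
From mathcomp Require Import cardinality fsbigop.

Set Implicit Arguments.
Unset Strict Implicit.
Unset Printing Implicit Defensive.

Import GRing.Theory.
Local Open Scope classical_set_scope.
Local Open Scope quotient_scope.
Local Open Scope ring_scope.

Record nualg (K : fieldType) := NUAlg {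
  nualg_sort :> lmodType K;
  nmul : nualg_sort -> nualg_sort -> nualg_sort;
  nmulA : associative nmul;
  nmulDl : left_distributive nmul +%R;
  nmulDr : right_distributive nmul +%R;
  nscaleAl : forall (c : K) a b, c *: nmul a b = nmul (c *: a) b;
  nscaleAr : forall (c : K) a b, c *: nmul a b = nmul a (c *: b) }.

Definition nualg_hom (K : fieldType) (A B : nualg K) (f : A -> B) : Prop :=
  linear f /\ {morph f : a b / nmul a b >-> nmul a b}.

Definition nualg_iso (K : fieldType) (A B : nualg K) : Prop :=
  exists2 f : A -> B, nualg_hom f & bijective f.

Section Semisimple.
Variables (K : fieldType) (A : nualg K).

(* Ideals are ideals of the underlying ring: no stability under scalars. *)
Definition add_subgroup (I : set A) : Prop :=
  I 0 /\ (forall a b, I a -> I b -> I (a - b)).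

Definition left_ideal (I : set A) : Prop :=
  add_subgroup I /\ (forall a b, I b -> I (nmul a b)).

Definition two_sided_ideal (I : set A) : Prop :=
  left_ideal I /\ (forall a b, I a -> I (nmul a b)).

Definition minimal_left_ideal (L : set A) : Prop :=
  [/\ left_ideal L, L <> [set 0] &
      forall J, left_ideal J -> J `<=` L -> J = [set 0] \/ J = L].

Definition semiprime : Prop :=
  forall I : set A, two_sided_ideal I ->
    (forall a b, I a -> I b -> nmul a b = 0) -> I = [set 0].

Definition socle : set A :=
  [set a | exists2 s : seq A,
     (forall b, b \in s -> exists2 L, minimal_left_ideal L & L b) &
     a = \sum_(b <- s) b].

Definition semisimple : Prop := semiprime /\ socle = setT.

End Semisimple.

Section Terms.
Variables (K : fieldType) (G : Type).

Inductive term : Type :=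
| TGen of G
| TZero
| TOpp of term
| TAdd of term & term
| TScale of K & term
| TMul of term & term.

HB.instance Definition _ := gen_eqMixin term.
HB.instance Definition _ := gen_choiceMixin term.

Fixpoint teval (A : nualg K) (phi : G -> A) (t : term) : A :=
  match t with
  | TGen g => phi g
  | TZero => 0
  | TOpp t => - teval phi t
  | TAdd t u => teval phi t + teval phi u
  | TScale c t => c *: teval phi t
  | TMul t u => nmul (teval phi t) (teval phi u)
  end.

(* The least congruence on terms containing [R] and the algebra axioms. *)
Inductive tcong (R : term -> term -> Prop) : term -> term -> Prop :=
| tc_rel t u : R t u -> tcong R t u
| tc_refl t : tcong R t t
| tc_sym t u : tcong R t u -> tcong R u t
| tc_trans t u v : tcong R t u -> tcong R u v -> tcong R t v
| tc_opp t t' : tcong R t t' -> tcong R (TOpp t) (TOpp t')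
| tc_add t t' u u' : tcong R t t' -> tcong R u u' ->
    tcong R (TAdd t u) (TAdd t' u')
| tc_scale c t t' : tcong R t t' -> tcong R (TScale c t) (TScale c t')
| tc_mul t t' u u' : tcong R t t' -> tcong R u u' ->
    tcong R (TMul t u) (TMul t' u')
| tc_addA t u v : tcong R (TAdd t (TAdd u v)) (TAdd (TAdd t u) v)
| tc_addC t u : tcong R (TAdd t u) (TAdd u t)
| tc_add0 t : tcong R (TAdd TZero t) t
| tc_addN t : tcong R (TAdd (TOpp t) t) TZero
| tc_scaleA a b t : tcong R (TScale a (TScale b t)) (TScale (a * b) t)
| tc_scale1 t : tcong R (TScale 1 t) t
| tc_scaleDr a t u :
    tcong R (TScale a (TAdd t u)) (TAdd (TScale a t) (TScale a u))
| tc_scaleDl a b t :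
    tcong R (TScale (a + b) t) (TAdd (TScale a t) (TScale b t))
| tc_mulA t u v : tcong R (TMul t (TMul u v)) (TMul (TMul t u) v)
| tc_mulDl t u v : tcong R (TMul (TAdd t u) v) (TAdd (TMul t v) (TMul u v))
| tc_mulDr t u v : tcong R (TMul t (TAdd u v)) (TAdd (TMul t u) (TMul t v))
| tc_scaleAl a t u : tcong R (TScale a (TMul t u)) (TMul (TScale a t) u)
| tc_scaleAr a t u : tcong R (TScale a (TMul t u)) (TMul t (TScale a u)).

End Terms.

Arguments TGen {K G}.
Arguments TZero {K G}.

Section Presented.
Variables (K : fieldType) (G : Type) (R : term K G -> term K G -> Prop).

Definition tcongb (t u : term K G) : bool := `[< tcong R t u >].

Lemma tcongb_refl : reflexive tcongb.
Proof. by move=> t; apply/asboolP; exact: tc_refl. Qed.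

Lemma tcongb_sym : symmetric tcongb.
Proof. by move=> t u; apply/asboolP/asboolP; exact: tc_sym. Qed.

Lemma tcongb_trans : transitive tcongb.
Proof.
move=> u t v /asboolP tu /asboolP uv; apply/asboolP; exact: tc_trans tu uv.
Qed.

Canonical tcong_equiv := EquivRel tcongb tcongb_refl tcongb_sym tcongb_trans.

Definition presented : Type := {eq_quot tcong_equiv}.
HB.instance Definition _ := Choice.on presented.
HB.instance Definition _ := Quotient.on presented.
HB.instance Definition _ := EqQuotient.on presented.

Lemma piP (t u : term K G) :
  (\pi_presented t = \pi_presented u) <-> tcong R t u.
Proof.
split=> [/eqquotP/asboolP //|tu]; apply/eqquotP; exact/asboolP.
Qed.

Lemma repr_cong (t : term K G) : tcong R (repr (\pi_presented t)) t.
Proof. by apply/piP; rewrite reprK. Qed.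

Definition pzero : presented := \pi_presented TZero.
Definition popp (a : presented) : presented := \pi_presented (TOpp (repr a)).
Definition padd (a b : presented) : presented :=
  \pi_presented (TAdd (repr a) (repr b)).
Definition pscale (c : K) (a : presented) : presented :=
  \pi_presented (TScale c (repr a)).
Definition pmul (a b : presented) : presented :=
  \pi_presented (TMul (repr a) (repr b)).

Lemma pi_opp t : popp (\pi_presented t) = \pi_presented (TOpp t).
Proof. by apply/piP/tc_opp/repr_cong. Qed.
Lemma pi_add t u :
  padd (\pi_presented t) (\pi_presented u) = \pi_presented (TAdd t u).
Proof. by apply/piP/tc_add; exact: repr_cong. Qed.
Lemma pi_scale c t : pscale c (\pi_presented t) = \pi_presented (TScale c t).
Proof. by apply/piP/tc_scale/repr_cong. Qed.
Lemma pi_mul t u :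
  pmul (\pi_presented t) (\pi_presented u) = \pi_presented (TMul t u).
Proof. by apply/piP/tc_mul; exact: repr_cong. Qed.

Fact paddA : associative padd.
Proof.
elim/quotW=> t; elim/quotW=> u; elim/quotW=> v.
by rewrite (pi_add u v) !(pi_add t) pi_add; apply/piP; apply: tc_addA.
Qed.
Fact paddC : commutative padd.
Proof.
by elim/quotW=> t; elim/quotW=> u; rewrite !pi_add; apply/piP; apply: tc_addC.
Qed.
Fact padd0 : left_id pzero padd.
Proof. by elim/quotW=> t; rewrite pi_add; apply/piP; apply: tc_add0. Qed.
Fact paddN : left_inverse pzero popp padd.
Proof. by elim/quotW=> t; rewrite pi_opp pi_add; apply/piP; apply: tc_addN. Qed.

HB.instance Definition _ :=
  GRing.isZmodule.Build presented paddA paddC padd0 paddN.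

Lemma pi_addr t u :
  \pi_presented t + \pi_presented u = \pi_presented (TAdd t u) :> presented.
Proof. exact: pi_add. Qed.

Fact pscaleA a b v : pscale a (pscale b v) = pscale (a * b) v.
Proof. by elim/quotW: v => t; rewrite (pi_scale b t) !pi_scale; apply/piP; apply: tc_scaleA. Qed.
Fact pscale1 : left_id 1 pscale.
Proof. by elim/quotW=> t; rewrite pi_scale; apply/piP; apply: tc_scale1. Qed.
Fact pscaleDr : right_distributive pscale +%R.
Proof.
move=> a; elim/quotW=> t; elim/quotW=> u.
rewrite (pi_addr t u) (pi_scale a t) (pi_scale a u) pi_scale pi_addr.
by apply/piP; apply: tc_scaleDr.
Qed.
Fact pscaleDl v : {morph pscale^~ v : a b / a + b}.
Proof.
move=> a b; elim/quotW: v => t.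
rewrite (pi_scale a t) (pi_scale b t) pi_scale pi_addr.
by apply/piP; apply: tc_scaleDl.
Qed.

HB.instance Definition _ := GRing.Zmodule_isLmodule.Build K presented
  pscaleA pscale1 pscaleDr pscaleDl.

Lemma pi_scaler c t :
  c *: (\pi_presented t : presented) = \pi_presented (TScale c t).
Proof. exact: pi_scale. Qed.

Fact pmulA : associative pmul.
Proof.
elim/quotW=> t; elim/quotW=> u; elim/quotW=> v.
by rewrite (pi_mul u v) !(pi_mul t) pi_mul; apply/piP; apply: tc_mulA.
Qed.
Fact pmulDl : left_distributive pmul +%R.
Proof.
elim/quotW=> t; elim/quotW=> u; elim/quotW=> v.
rewrite (pi_addr t u) (pi_mul t v) (pi_mul u v) pi_mul pi_addr.
by apply/piP; apply: tc_mulDl.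
Qed.
Fact pmulDr : right_distributive pmul +%R.
Proof.
elim/quotW=> t; elim/quotW=> u; elim/quotW=> v.
rewrite (pi_addr u v) (pi_mul t u) (pi_mul t v) pi_mul pi_addr.
by apply/piP; apply: tc_mulDr.
Qed.
Fact pscaleAl (c : K) a b : c *: pmul a b = pmul (c *: a) b.
Proof.
elim/quotW: a => t; elim/quotW: b => u.
rewrite (pi_mul t u) !pi_scaler pi_mul.
by apply/piP; apply: tc_scaleAl.
Qed.
Fact pscaleAr (c : K) a b : c *: pmul a b = pmul a (c *: b).
Proof.
elim/quotW: a => t; elim/quotW: b => u.
rewrite (pi_mul t u) !pi_scaler pi_mul.
by apply/piP; apply: tc_scaleAr.
Qed.

Definition presented_alg : nualg K :=
  @NUAlg K presented pmul pmulA pmulDl pmulDr pscaleAl pscaleAr.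

Definition pgen (g : G) : presented_alg := \pi_presented (TGen g).

Lemma teval_pgen (t : term K G) : teval pgen t = \pi_presented t.
Proof.
elim: t => //= [t ->|t -> u ->|c t ->|t -> u ->].
- exact: pi_opp.
- exact: pi_add.
- exact: pi_scale.
- exact: pi_mul.
Qed.

Lemma pgen_rel (t u : term K G) : R t u -> teval pgen t = teval pgen u.
Proof. by move=> tu; rewrite !teval_pgen; exact/piP/tc_rel. Qed.

Lemma teval_hom (A B : nualg K) (f : A -> B) (phi : G -> A) (t : term K G) :
  nualg_hom f -> f (teval phi t) = teval (f \o phi) t.
Proof.
move=> [flin fmul].
pose F := GRing.isLinear.Build K A B *:%R f flin.
pose f' : {linear A -> B} := HB.pack f F.
elim: t => //= [|t <-|t <- u <-|c t <-|t <- u <-].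
- exact: (raddf0 f').
- exact: (raddfN f').
- exact: (raddfD f').
- exact: (linearZ_LR f').
- exact: fmul.
Qed.

Lemma teval_cong (A : nualg K) (phi : G -> A) :
  (forall t u, R t u -> teval phi t = teval phi u) ->
  forall t u, tcong R t u -> teval phi t = teval phi u.
Proof.
move=> phiR t u; elim=> //=.
- by move=> ? ? ? _ -> _ ->.
- by move=> ? ? _ ->.
- by move=> ? ? ? ? _ -> _ ->.
- by move=> ? ? ? _ ->.
- by move=> ? ? ? ? _ -> _ ->.
- by move=> *; rewrite addrA.
- by move=> *; rewrite addrC.
- by move=> *; rewrite add0r.
- by move=> *; rewrite addNr.
- by move=> *; rewrite scalerA.
- by move=> *; rewrite scale1r.
- by move=> *; rewrite scalerDr.
- by move=> *; rewrite scalerDl.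
- by move=> *; rewrite nmulA.
- by move=> *; rewrite nmulDl.
- by move=> *; rewrite nmulDr.
- by move=> *; rewrite nscaleAl.
- by move=> *; rewrite nscaleAr.
Qed.

Theorem presented_universal (A : nualg K) (phi : G -> A) :
  (forall t u, R t u -> teval phi t = teval phi u) ->
  exists! f : presented_alg -> A, nualg_hom f /\ (forall g, f (pgen g) = phi g).
Proof.
move=> /teval_cong phiR.
pose f (a : presented_alg) : A := teval phi (repr (a : presented)).
have fE t : f (\pi_presented t) = teval phi t by apply: phiR; exact: repr_cong.
exists f; split=> [|f' [f'hom f'gen]]; first (split=> [|g]; last exact: fE).
  split=> [c|]; elim/quotW=> t; elim/quotW=> u.
    have -> : c *: (\pi_presented t : presented_alg) + \pi_presented u =
        \pi_presented (TAdd (TScale c t) u).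
      by rewrite -pi_addr -pi_scaler.
    by rewrite !fE.
  by rewrite /nmul /= pi_mul !fE.
apply/funext; elim/quotW=> t; rewrite fE -teval_pgen teval_hom //.
by congr teval; apply/funext => g /=; rewrite f'gen.
Qed.

End Presented.

Section FinSupp.
Variables (K : fieldType) (I : Type) (V : lmodType K).

Definition fin_supp : {pred I -> V} :=
  fun f => `[< finite_set [set i | f i != 0] >].

Fact fin_supp_submod : submod_closed fin_supp.
Proof.
split=> [|c f g /asboolP fF /asboolP gF]; apply/asboolP.
  by rewrite (_ : [set _ | _] = set0) //; apply/seteqP; split=> i //=; rewrite eqxx.
apply: (@sub_finite_set _ _ ([set i | f i != 0] `|` [set i | g i != 0])).
  move=> i /=; have [fi0|] := eqVneq (f i) 0; last by left.
  have [gi0|] := eqVneq (g i) 0; last by right.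
  by rewrite /GRing.add /= /GRing.scale /= fi0 gi0 scaler0 addr0 eqxx.
by rewrite finite_setU.
Qed.

HB.instance Definition _ :=
  GRing.isSubmodClosed.Build K (I -> V) fin_supp fin_supp_submod.

Record fsfunc := FSFunc { fs_val :> I -> V; fs_valP : fs_val \in fin_supp }.

HB.instance Definition _ := [isSub for fs_val].
HB.instance Definition _ := [Choice of fsfunc by <:].
HB.instance Definition _ := [SubChoice_isSubLmodule of fsfunc by <:].

Lemma fs_finite (f : fsfunc) : finite_set [set i | f i != 0].
Proof. exact/asboolP/fs_valP. Qed.

Lemma fsfuncP (f g : fsfunc) : (forall i, f i = g i) -> f = g.
Proof. by move=> fg; apply/val_inj/funext. Qed.

End FinSupp.

Arguments fs_finite {K I V}.

Section DirectSum.
Variables (K : fieldType) (I : Type) (A : nualg K).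

Lemma nmul0l (a : A) : nmul 0 a = 0.
Proof. by apply: (addrI (nmul 0 a)); rewrite -nmulDl !addr0. Qed.

Fact dsum_mul_subproof (f g : fsfunc I A) :
  (fun i => nmul (f i) (g i)) \in @fin_supp K I A.
Proof.
apply/asboolP/(sub_finite_set _ (fs_finite f)) => i /=.
by apply: contra => /eqP->; rewrite nmul0l.
Qed.

Definition dsum_mul (f g : fsfunc I A) : fsfunc I A :=
  FSFunc (dsum_mul_subproof f g).

Fact dsum_mulA : associative dsum_mul.
Proof. by move=> f g h; apply/fsfuncP => i /=; rewrite nmulA. Qed.
Fact dsum_mulDl : left_distributive dsum_mul +%R.
Proof. by move=> f g h; apply/fsfuncP => i /=; rewrite !fctE nmulDl. Qed.
Fact dsum_mulDr : right_distributive dsum_mul +%R.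
Proof. by move=> f g h; apply/fsfuncP => i /=; rewrite !fctE nmulDr. Qed.
Fact dsum_scaleAl (c : K) f g : c *: dsum_mul f g = dsum_mul (c *: f) g.
Proof. by apply/fsfuncP => i /=; rewrite !fctE nscaleAl. Qed.
Fact dsum_scaleAr (c : K) f g : c *: dsum_mul f g = dsum_mul f (c *: g).
Proof. by apply/fsfuncP => i /=; rewrite !fctE nscaleAr. Qed.

(* The direct sum of copies of [A] indexed by [I]. *)
Definition direct_sum : nualg K :=
  NUAlg dsum_mulA dsum_mulDl dsum_mulDr dsum_scaleAl dsum_scaleAr.

End DirectSum.

Section MatInf.
Variable K : fieldType.

(* Matrices indexed by nat * nat with finitely many nonzero entries; K^o is K
   as a module over itself. *)
Definition matinf : lmodType K := fsfunc (nat * nat) K^o.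
Implicit Types A B C : fsfunc (nat * nat) K^o.

Lemma matinf_bound A :
  exists N, forall i j, (N <= i)%N || (N <= j)%N -> A (i, j) = 0.
Proof.
have /finite_seqP[s sE] := fs_finite A.
exists (\max_(p <- s) maxn p.1 p.2).+1 => i j ij; apply/eqP.
apply: contraTT ij => Aij; rewrite negb_or -!ltnNge !ltnS -geq_max.
have ps : (i, j) \in s by have : [set` s] (i, j) by rewrite -sE.
by rewrite (big_rem _ ps) /= leq_max leqnn.
Qed.

Lemma fsbig_bound N (F : nat -> K) :
  (forall l, (N <= l)%N -> F l = 0) ->
  \sum_(l \in [set: nat]) F l = \sum_(l < N) F l.
Proof.
move=> F0; rewrite fsbig_ord; symmetry; apply: fsbig_widen => // l [_ /=].
by move=> /negP; rewrite -leqNgt => /F0.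
Qed.

Definition mat_mulf A B (ij : nat * nat) : K :=
  \sum_(l \in [set: nat]) A (ij.1, l) * B (l, ij.2).

Lemma mat_mulf_bound N A B i j :
  (forall i j, (N <= i)%N || (N <= j)%N -> A (i, j) = 0) ->
  mat_mulf A B (i, j) = \sum_(l < N) A (i, val l) * B (val l, j).
Proof. by move=> A0; apply: fsbig_bound => l Nl; rewrite A0 ?mul0r ?Nl ?orbT. Qed.

Fact mat_mul_subproof A B :
  (mat_mulf A B : _ -> K^o) \in @fin_supp K (nat * nat) K^o.
Proof.
have [N A0] := matinf_bound A; have [M B0] := matinf_bound B.
apply/asboolP.
apply: (@sub_finite_set _ _ (`I_N `*` `I_M)); last first.
  by apply: finite_setX; exact: finite_II.
move=> [i j] /=; rewrite (mat_mulf_bound _ _ _ A0) => /eqP AB; split=> /=.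
  rewrite ltnNge; apply/negP => Ni; apply: AB.
  by rewrite big1 // => l _; rewrite A0 ?mul0r ?Ni.
rewrite ltnNge; apply/negP => Mj; apply: AB.
by rewrite big1 // => l _; rewrite B0 ?mulr0 ?Mj ?orbT.
Qed.

Definition mat_mul (A B : matinf) : matinf := FSFunc (mat_mul_subproof A B).

Fact mat_mulA : associative mat_mul.
Proof.
move=> A B C; apply/fsfuncP => -[i j] /=.
have [N A0] := matinf_bound A; have [M B0] := matinf_bound B.
have [P AB0] := matinf_bound (mat_mul A B).
pose Q := maxn N (maxn M P).
have wid (D : fsfunc (nat * nat) K^o) k : (k <= Q)%N ->
    (forall i j, (k <= i)%N || (k <= j)%N -> D (i, j) = 0) ->
    forall i j, (Q <= i)%N || (Q <= j)%N -> D (i, j) = 0.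
  move=> kQ D0 a b ab; apply: D0.
  by case/orP: ab => /(leq_trans kQ) ->; rewrite ?orbT.
have {}A0 := wid _ N (leq_maxl _ _) A0.
have {}B0 := wid _ M (leq_trans (leq_maxl _ _) (leq_maxr _ _)) B0.
have {}AB0 := wid _ P (leq_trans (leq_maxr _ _) (leq_maxr _ _)) AB0.
rewrite (mat_mulf_bound _ _ _ A0) (mat_mulf_bound _ _ _ AB0) /=.
under eq_bigr do rewrite (mat_mulf_bound _ _ _ B0) mulr_sumr.
under [RHS]eq_bigr do rewrite (mat_mulf_bound _ _ _ A0) mulr_suml.
rewrite exchange_big /=; apply: eq_bigr => m _; apply: eq_bigr => l _.
by rewrite mulrA.
Qed.

Fact mat_mulDl : left_distributive mat_mul +%R.
Proof.
move=> A B C; apply/fsfuncP => -[i j].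
rewrite /= !fctE /=.
have [N C0] := matinf_bound C.
have E D : mat_mulf D C (i, j) = \sum_(l < N) D (i, val l) * C (val l, j).
  by apply: fsbig_bound => l Nl; rewrite C0 ?mulr0 ?Nl.
rewrite !E -big_split; apply: eq_bigr => l _ /=.
by rewrite fctE mulrDl.
Qed.

Fact mat_mulDr : right_distributive mat_mul +%R.
Proof.
move=> A B C; apply/fsfuncP => -[i j].
rewrite /= !fctE /=.
have [N A0] := matinf_bound A.
rewrite !(mat_mulf_bound _ _ _ A0) -big_split; apply: eq_bigr => l _ /=.
by rewrite fctE mulrDr.
Qed.

Fact mat_scaleAl (c : K) A B :
  c *: (mat_mul A B : matinf) = mat_mul (c *: (A : matinf)) B.
Proof.
apply/fsfuncP => -[i j]; rewrite /= !fctE /=.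
have [N B0] := matinf_bound B.
have E D : mat_mulf D B (i, j) = \sum_(l < N) D (i, val l) * B (val l, j).
  by apply: fsbig_bound => l Nl; rewrite B0 ?mulr0 ?Nl.
rewrite !E scaler_sumr; apply: eq_bigr => l _ /=.
by rewrite fctE scalerAl.
Qed.

Fact mat_scaleAr (c : K) A B :
  c *: (mat_mul A B : matinf) = mat_mul A (c *: (B : matinf)).
Proof.
apply/fsfuncP => -[i j]; rewrite /= !fctE /=.
have [N A0] := matinf_bound A.
rewrite !(mat_mulf_bound _ _ _ A0) scaler_sumr; apply: eq_bigr => l _ /=.
by rewrite fctE scalerAr.
Qed.

Definition mat_infty : nualg K :=
  NUAlg mat_mulA mat_mulDl mat_mulDr mat_scaleAl mat_scaleAr.

End MatInf.

Section Degree.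
Variable k : nat.

Definition degree : Type := {ffun 'I_k -> nat}.
HB.instance Definition _ := Countable.on degree.
HB.instance Definition _ := GRing.Nmodule.on degree.

Implicit Types m n p : degree.

Definition lek m n : bool := [forall i, (m i <= n i)%N].
Definition subk m n : degree := [ffun i => (m i - n i)%N].

Lemma lek_refl m : lek m m.
Proof. exact/forallP. Qed.

Lemma lek_trans n m p : lek m n -> lek n p -> lek m p.
Proof.
by move=> /forallP mn /forallP np; apply/forallP => i; exact: leq_trans (np i).
Qed.

Lemma addkE m n i : (m + n) i = (m i + n i)%N.
Proof. by rewrite ffunE. Qed.

Lemma lek_add2r p m n : lek (m + p) (n + p) = lek m n.
Proof. by apply: eq_forallb => i; rewrite !addkE leq_add2r. Qed.

Lemma lek_addr m n : lek m (m + n).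
Proof. by apply/forallP => i; rewrite addkE leq_addr. Qed.

Lemma subk_add2r p m n : subk (n + p) (m + p) = subk n m.
Proof. by apply/ffunP => i; rewrite !ffunE subnDr. Qed.

Lemma subkk m : subk m m = 0.
Proof. by apply/ffunP => i; rewrite !ffunE subnn. Qed.

Lemma subkK m n : lek m n -> m + subk n m = n.
Proof.
by move=> /forallP mn; apply/ffunP => i; rewrite addkE ffunE subnKC.
Qed.

Lemma addkK m n : subk (m + n) m = n.
Proof. by apply/ffunP => i; rewrite !ffunE addKn. Qed.

End Degree.

(* [kcomp l m] is the path written [l m]; it is meaningful only when
   [src l = rng m], and nothing is assumed about its other values. *)
Record kgraph (k : nat) := KGraph {
  kvert : countType;
  kpath : countType;
  rng : kpath -> kvert;
  src : kpath -> kvert;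
  kid : kvert -> kpath;
  kcomp : kpath -> kpath -> kpath;
  deg : kpath -> degree k;
  rng_id : forall v, rng (kid v) = v;
  src_id : forall v, src (kid v) = v;
  rng_comp : forall l m, src l = rng m -> rng (kcomp l m) = rng l;
  src_comp : forall l m, src l = rng m -> src (kcomp l m) = src m;
  comp_idl : forall l, kcomp (kid (rng l)) l = l;
  comp_idr : forall l, kcomp l (kid (src l)) = l;
  compA : forall l m n, src l = rng m -> src m = rng n ->
    kcomp l (kcomp m n) = kcomp (kcomp l m) n;
  deg_id : forall v, deg (kid v) = 0;
  deg_comp : forall l m, src l = rng m -> deg (kcomp l m) = deg l + deg m;
  factorization : forall l m n, deg l = m + n ->
    exists! p : kpath * kpath,
      [/\ src p.1 = rng p.2, deg p.1 = m, deg p.2 = n & l = kcomp p.1 p.2] }.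

Definition paths_at k (L : kgraph k) (v : kvert L) (n : degree k) :
  set (kpath L) := [set l | rng l = v /\ deg l = n].

Definition row_finite_no_sources k (L : kgraph k) : Prop :=
  forall (v : kvert L) (n : degree k),
    paths_at v n !=set0 /\ finite_set (paths_at v n).

Record kfunctor k (G H : kgraph k) := KFunctor {
  fobj : kvert G -> kvert H;
  fmor : kpath G -> kpath H;
  fmor_rng : forall l, rng (fmor l) = fobj (rng l);
  fmor_src : forall l, src (fmor l) = fobj (src l);
  fmor_id : forall v, fmor (kid v) = kid (fobj v);
  fmor_comp : forall l m, src l = rng m ->
    fmor (kcomp l m) = kcomp (fmor l) (fmor m);
  fmor_deg : forall l, deg (fmor l) = deg l }.

Lemma kfunctorP k (G H : kgraph k) (x y : kfunctor G H) :
  (forall l, fmor x l = fmor y l) -> x = y.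
Proof.
move=> xy.
have exy v : fobj x v = fobj y v.
  by rewrite -[LHS]rng_id -fmor_id xy fmor_id rng_id.
case: x y xy exy => [fo fm p1 p2 p3 p4 p5] [go gm q1 q2 q3 q4 q5] /=.
move=> /funext E /funext E'.
case: gm / E q1 q2 q3 q4 q5 => q1 q2 q3 q4 q5.
case: go / E' q1 q2 q3 q4 q5 => q1 q2 q3 q4 q5.
by congr KFunctor; exact: Prop_irrelevance.
Qed.

Section Omega.
Variable k : nat.

Definition omega_path := {p : degree k * degree k | lek p.1 p.2}.

Implicit Types e f g : omega_path.

Definition omega_rng e : degree k := (val e).1.
Definition omega_src e : degree k := (val e).2.
Definition omega_id (m : degree k) : omega_path := exist _ (m, m) (lek_refl m).
(* [(m, n) (n, p) = (m, p)]; the default value [e] of [insubd] is only used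
   when [e] and [f] are not composable. *)
Definition omega_comp e f : omega_path := insubd e (omega_rng e, omega_src f).
Definition omega_deg e : degree k := subk (omega_src e) (omega_rng e).

Lemma omega_compE e f : omega_src e = omega_rng f ->
  val (omega_comp e f) = (omega_rng e, omega_src f).
Proof.
move=> ef; rewrite val_insubd ifT //=.
by apply: (lek_trans (valP e)); rewrite -/(omega_src e) ef; exact: (valP f).
Qed.

Lemma omegaP e f :
  omega_rng e = omega_rng f -> omega_src e = omega_src f -> e = f.
Proof.
case: e f => [[a b] ab] [[c d] cd]; rewrite /omega_rng /omega_src /= => E E'.
by apply: val_inj; rewrite /= E E'.
Qed.

Fact omega_rng_comp e f : omega_src e = omega_rng f ->
  omega_rng (omega_comp e f) = omega_rng e.
Proof. by move=> ef; rewrite [LHS]/omega_rng omega_compE. Qed.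

Fact omega_src_comp e f : omega_src e = omega_rng f ->
  omega_src (omega_comp e f) = omega_src f.
Proof. by move=> ef; rewrite [LHS]/omega_src omega_compE. Qed.

Fact omega_idl e : omega_comp (omega_id (omega_rng e)) e = e.
Proof. by apply: omegaP; rewrite ?omega_rng_comp ?omega_src_comp. Qed.

Fact omega_idr e : omega_comp e (omega_id (omega_src e)) = e.
Proof. by apply: omegaP; rewrite ?omega_rng_comp ?omega_src_comp. Qed.

Fact omega_compA e f g : omega_src e = omega_rng f ->
  omega_src f = omega_rng g ->
  omega_comp e (omega_comp f g) = omega_comp (omega_comp e f) g.
Proof.
move=> ef fg.
have efg : omega_src e = omega_rng (omega_comp f g) by rewrite omega_rng_comp.
have efg' : omega_src (omega_comp e f) = omega_rng g by rewrite omega_src_comp.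
by apply: omegaP; rewrite ?omega_rng_comp ?omega_src_comp ?omega_rng_comp.
Qed.

Fact omega_deg_id m : omega_deg (omega_id m) = 0.
Proof. exact: subkk. Qed.

Fact omega_deg_comp e f : omega_src e = omega_rng f ->
  omega_deg (omega_comp e f) = omega_deg e + omega_deg f.
Proof.
move=> ef; rewrite /omega_deg omega_rng_comp // omega_src_comp //.
have /forallP le1 := valP e; have /forallP le2 := valP f.
apply/ffunP => i; rewrite addkE !ffunE -ef.
have := le1 i; have := le2 i.
rewrite -/(omega_rng e) -/(omega_src e) -/(omega_src f) -/(omega_rng f) -ef.
by move=> h2 h1; rewrite addnC addnBA // subnK.
Qed.

Fact omega_factorization e (m n : degree k) : omega_deg e = m + n ->
  exists! p : omega_path * omega_path,
    [/\ omega_src p.1 = omega_rng p.2, omega_deg p.1 = m, omega_deg p.2 = n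
      & e = omega_comp p.1 p.2].
Proof.
move=> emn.
have es : omega_src e = omega_rng e + m + n.
  by rewrite -addrA -emn; symmetry; exact: subkK (valP e).
pose e1 : omega_path := exist _ (omega_rng e, omega_rng e + m) (lek_addr _ _).
pose e2 : omega_path :=
  exist _ (omega_rng e + m, omega_rng e + m + n) (lek_addr _ _).
exists (e1, e2); split=> [|[f g] /= [fg fm gn efg]].
  split=> //=; [exact: addkK | exact: addkK |].
  by apply: omegaP; rewrite ?omega_rng_comp ?omega_src_comp // es.
have ef : omega_rng e = omega_rng f by rewrite efg omega_rng_comp.
have eg : omega_src e = omega_src g by rewrite efg omega_src_comp.
have fs : omega_src f = omega_rng e + m.
  by rewrite ef -fm; symmetry; exact: subkK (valP f).
congr pair; apply: omegaP => //; rewrite -?fg ?fs //.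
by rewrite -eg es.
Qed.

Definition Omega : kgraph k :=
  @KGraph k (degree k) omega_path omega_rng omega_src omega_id omega_comp
    omega_deg (fun=> erefl) (fun=> erefl) omega_rng_comp omega_src_comp
    omega_idl omega_idr omega_compA omega_deg_id omega_deg_comp
    omega_factorization.

Fact omega_shift_subproof (p : degree k) e :
  lek (omega_rng e + p) (omega_src e + p).
Proof. by rewrite lek_add2r; exact: (valP e). Qed.

Definition omega_shift (p : degree k) e : omega_path :=
  exist _ (omega_rng e + p, omega_src e + p) (omega_shift_subproof p e).

End Omega.

Section InfinitePaths.
Variables (k : nat) (L : kgraph k).

Definition infpath := kfunctor (Omega k) L.

Section Shift.
Variables (p : degree k) (x : infpath).

Let so (m : kvert (Omega k)) : kvert L :=
  fobj x ((m : degree k) + p : degree k).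
Let sm (e : kpath (Omega k)) : kpath L := fmor x (omega_shift p e).

Fact shift_rng e : rng (sm e) = so (rng e). Proof. exact: fmor_rng. Qed.
Fact shift_src e : src (sm e) = so (src e). Proof. exact: fmor_src. Qed.
Fact shift_id m : sm (kid m) = kid (so m).
Proof. by rewrite /sm /so -fmor_id; congr (fmor x _); exact: omegaP. Qed.
Fact shift_comp e f : src e = rng f -> sm (kcomp e f) = kcomp (sm e) (sm f).
Proof.
move=> ef; have ef' : omega_src (omega_shift p e) = omega_rng (omega_shift p f).
  by congr (_ + p); exact: ef.
rewrite /sm -fmor_comp //; congr (fmor x _); apply: omegaP.
  rewrite [RHS]omega_rng_comp // /omega_shift [LHS]/omega_rng /=.
  by rewrite omega_rng_comp.
rewrite [RHS]omega_src_comp // /omega_shift [LHS]/omega_src /=.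
by rewrite omega_src_comp.
Qed.
Fact shift_deg e : deg (sm e) = deg e.
Proof. by rewrite fmor_deg; exact: subk_add2r. Qed.

Definition shift : infpath :=
  KFunctor shift_rng shift_src shift_id shift_comp shift_deg.

End Shift.

Definition periodic (x : infpath) : Prop :=
  exists p q : degree k, p <> q /\ shift p x = shift q x.

Definition aperiodic (x : infpath) : Prop := ~ periodic x.

Definition inf_vertex (x : infpath) (m : degree k) : kvert L :=
  fobj x (m : kvert (Omega k)).

Definition infpaths_at (v : kvert L) : set infpath :=
  [set x | inf_vertex x 0 = v].

Definition line_points : set (kvert L) :=
  [set v | exists2 x, infpaths_at v = [set x] & aperiodic x].

(* Only meaningful for line points. *)
Definition line_equiv (v w : kvert L) : Prop :=
  exists x y, [/\ infpaths_at v = [set x], infpaths_at w = [set y] &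
    exists m n, inf_vertex x m = inf_vertex y n].

Definition line_class (v : kvert L) : set (kvert L) :=
  [set w | line_points w /\ line_equiv v w].

(* The set of equivalence classes, as a type. *)
Definition line_quotient : Type := set_type [set line_class v | v in line_points].

End InfinitePaths.

Section KumjianPask.
Variables (K : fieldType) (k : nat) (L : kgraph k).

Definition nzpath : Type := {l : kpath L | deg l != 0}.
HB.instance Definition _ := Countable.on nzpath.

Inductive kpgen : Type :=
| KPv of kvert L
| KPs of nzpath
| KPstar of nzpath.

(* ['t_ l] stands for the generator usually written s_{l^*}. *)
Local Notation "'p_ v" := (TGen (K := K) (KPv v)) (at level 8, v at level 2).
Local Notation "'s_ l" := (TGen (K := K) (KPs l)) (at level 8, l at level 2).
Local Notation "'t_ l" := (TGen (K := K) (KPstar l)) (at level 8, l at level 2).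
Local Notation "t ** u" := (TMul t u) (at level 40, left associativity).
Local Notation r := (fun l : nzpath => rng (val l)).
Local Notation s := (fun l : nzpath => src (val l)).
Local Notation d := (fun l : nzpath => deg (val l)).

Definition tsum (ts : seq (term K kpgen)) : term K kpgen :=
  foldr (@TAdd K kpgen) TZero ts.

(* In [kp2_comp] and [kp2_comp_star] the path [n] is the composite [l m]. In
   [kp4], [ls] is an enumeration without repetition of [v Lambda^n]. *)
Inductive kp_rel : term K kpgen -> term K kpgen -> Prop :=
| kp1_idem v : kp_rel ('p_ v ** 'p_ v) 'p_ v
| kp1_orth v w : v <> w -> kp_rel ('p_ v ** 'p_ w) TZero
| kp2_comp (l m n : nzpath) : r m = s l -> val n = kcomp (val l) (val m) ->
    kp_rel ('s_ l ** 's_ m) 's_ n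
| kp2_comp_star (l m n : nzpath) :
    r m = s l -> val n = kcomp (val l) (val m) ->
    kp_rel ('t_ m ** 't_ l) 't_ n
| kp2_rng l : kp_rel ('p_(r l) ** 's_ l) 's_ l
| kp2_src l : kp_rel ('s_ l ** 'p_(s l)) 's_ l
| kp2_src_star l : kp_rel ('p_(s l) ** 't_ l) 't_ l
| kp2_rng_star l : kp_rel ('t_ l ** 'p_(r l)) 't_ l
| kp3_eq l : kp_rel ('t_ l ** 's_ l) 'p_(s l)
| kp3_neq l m : d l = d m -> l <> m -> kp_rel ('t_ l ** 's_ m) TZero
| kp4 v (n : degree k) (ls : seq nzpath) : n != 0 -> uniq ls ->
    (forall l : nzpath, l \in ls <-> r l = v /\ d l = n) ->
    kp_rel 'p_ v (tsum [seq 's_ l ** 't_ l | l <- ls]).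

Definition KP : nualg K := presented_alg kp_rel.

End KumjianPask.

(* Main.v *)
Require Import Defs.
From HB Require Import structures.
From mathcomp Require Import all_boot all_order all_algebra.
From mathcomp Require Import generic_quotient.
From mathcomp Require Import mathcomp_extra boolp classical_sets functions.
From mathcomp Require Import cardinality fsbigop finmap.

Set Implicit Arguments.
Unset Strict Implicit.
Unset Printing Implicit Defensive.

Import GRing.Theory.
Local Open Scope classical_set_scope.
Local Open Scope ring_scope.

(** The pivot is the notion of a spanning family of matrix units
    [u c i j], with [c] in a set [C] and [i], [j] natural numbers: an algebra is
    isomorphic to the direct sum over [C] of the algebras of finite matrices if and
    only if it has such a family ([matrix_units_dsum], [standard_units], [matrix_units_iso]).

    An algebra with such a family is semisimple ([semisimple_from_units]).  Indeed
    a nonzero element [a] has a nonzero corner [u c i i * a * u c j j], which is a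
    multiple of [u c i j], and from a multiple of [u c i j] one reaches [u c j j].
    So a nonzero two-sided ideal contains an idempotent, and the left ideals
    generated by the [u c j j] are minimal; they add up to the algebra.

    Suppose conversely that the Kumjian-Pask algebra [A] is its own socle.  Each
    vertex idempotent [p_v] is then a finite sum of elements of minimal left ideals,
    so [A p_v] lies in a finite sum of minimal left ideals and an increasing
    sequence of left ideals in [A p_v] repeats after a bounded number of steps
    ([chain_stationary], [socle_chain]).  This has two consequences.  The idempotents
    [s_l s_l^*], for [l] from [v] of degree [n], are orthogonal and nonzero, so
    the number of these [l] is bounded as [n] varies; at a degree where it is
    largest the paths no longer branch beyond their sources ([thin_level]).  And
    if a vertex has one infinite path [x], whose shifts by [p] and [q] agree, then
    [t = s_(x(0,p)) s_(x(0,q))^*] is an element of infinite order, and the left ideals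
    generated by [p_v - t^(2^j)] decrease strictly ([thin_aperiodic]).  Both
    arguments need to know that certain elements do not vanish.  That is seen in
    one representation, on the functions of an infinite path and an integer, where
    the integer counts degrees along one coordinate and so tells apart the powers
    of [t].

    Hence from every vertex there is a degree at which all paths end in line points.
    For infinite paths [x] and [y] with a common tail, cut off where the tail
    starts at a line point, [s_(x(0,m)) s_(y(0,n))^*] depends on [x] and [y] alone:
    cutting later changes nothing by the last Kumjian-Pask relation, and [m - n]
    is determined by [x] and [y] because infinite paths are aperiodic
    ([unit_at_unique]).  These elements multiply as matrix units and span [A]
    ([tail_units_span]).  Their blocks are the tail classes of infinite paths,
    which correspond to the classes of line points, and each tail class is
    countably infinite: an aperiodic path has infinitely many shifts, and a path
    is determined by the initial segment that leads to a line point
    ([tail_class_enum]). *)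

(** * Linear spans in algebras without unit *)

Section NonUnitalAlgebra.
Variables (K : fieldType) (A : nualg K).
Implicit Types a b : A.

Lemma nmul0r a : nmul a 0 = 0.
Proof. by apply: (addrI (nmul a 0)); rewrite -nmulDr !addr0. Qed.

Lemma nmulNl a b : nmul (- a) b = - nmul a b.
Proof. by apply: (addrI (nmul a b)); rewrite -nmulDl !addrN nmul0l. Qed.

Lemma nmulNr a b : nmul a (- b) = - nmul a b.
Proof. by apply: (addrI (nmul a b)); rewrite -nmulDr !addrN nmul0r. Qed.

Lemma nmulBl a b c : nmul (a - b) c = nmul a c - nmul b c.
Proof. by rewrite nmulDl nmulNl. Qed.

Lemma nmulBr a b c : nmul c (a - b) = nmul c a - nmul c b.
Proof. by rewrite nmulDr nmulNr. Qed.

Lemma nmul_suml (I : Type) (s : seq I) (F : I -> A) b :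
  nmul (\sum_(i <- s) F i) b = \sum_(i <- s) nmul (F i) b.
Proof.
by elim: s => [|i s IH]; rewrite ?big_nil ?nmul0l // !big_cons nmulDl IH.
Qed.

Lemma nmul_sumr (I : Type) (s : seq I) (F : I -> A) b :
  nmul b (\sum_(i <- s) F i) = \sum_(i <- s) nmul b (F i).
Proof.
by elim: s => [|i s IH]; rewrite ?big_nil ?nmul0r // !big_cons nmulDr IH.
Qed.

Inductive lin_span (S : set A) : A -> Prop :=
| span0 : lin_span S 0
| spanDZ c a b : S a -> lin_span S b -> lin_span S (c *: a + b).

Lemma span_mem (S : set A) a : S a -> lin_span S a.
Proof. by move=> Sa; rewrite -[a]scale1r -[_ *: _]addr0; do !constructor. Qed.

Lemma spanD (S : set A) a b : lin_span S a -> lin_span S b -> lin_span S (a + b).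
Proof.
move=> Sa Sb; elim: Sa => [|c x y Sx _ IH]; first by rewrite add0r.
by rewrite -addrA; constructor.
Qed.

Lemma spanZ (S : set A) c a : lin_span S a -> lin_span S (c *: a).
Proof.
elim=> [|d x y Sx _ IH]; first by rewrite scaler0; constructor.
by rewrite scalerDr scalerA; constructor.
Qed.

Lemma span_sum (S : set A) (I : eqType) (s : seq I) (F : I -> A) :
  (forall i, i \in s -> lin_span S (F i)) -> lin_span S (\sum_(i <- s) F i).
Proof.
move=> SF; rewrite big_seq; elim/big_ind: _ => //; first exact: span0.
exact: spanD.
Qed.

Lemma spanM (S : set A) a b :
  (forall x y, S x -> S y -> lin_span S (nmul x y)) ->
  lin_span S a -> lin_span S b -> lin_span S (nmul a b).
Proof.
move=> SM Sa Sb; elim: Sa => [|c x y Sx _ IH]; first by rewrite nmul0l; constructor.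
rewrite nmulDl; apply: spanD => //; rewrite -nscaleAl; apply: spanZ.
elim: Sb => [|d z t Sz _ IH']; first by rewrite nmul0r; constructor.
by rewrite nmulDr -nscaleAr; apply: spanD => //; apply/spanZ/SM.
Qed.

End NonUnitalAlgebra.

(** * Matrix units and the direct sum of the algebras of finite matrices *)

Section FinSuppSingle.
Variables (K : fieldType) (I : eqType) (V : lmodType K) (i : I) (v : V).

Fact single_subproof : (fun j => if j == i then v else 0) \in @fin_supp K I V.
Proof.
apply/asboolP/(sub_finite_set _ (finite_set1 i)) => j /=.
by have [//|_] := eqVneq j i; rewrite eqxx.
Qed.

Definition single : fsfunc I V := FSFunc single_subproof.
End FinSuppSingle.

Lemma fsDZ (K : fieldType) (I : Type) (V : lmodType K) (a : K)
    (f g : fsfunc I V) i :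
  (a *: f + g) i = a *: f i + g i.
Proof. by []. Qed.

Section StandardUnits.
Variables (K : fieldType) (C : choiceType).
Local Notation D := (direct_sum C (mat_infty K)).
Implicit Types (f g : D) (c : C).

Definition entry f c i j : K := (f c : fsfunc _ _) (i, j).

Definition unit_mx c i j : D :=
  single c (single (i, j) (1 : K^o) : mat_infty K) : fsfunc C (mat_infty K).

Lemma entry_inj f g : (forall c i j, entry f c i j = entry g c i j) -> f = g.
Proof. by move=> fg; apply: fsfuncP => c; apply: fsfuncP => -[i j]; exact: fg. Qed.

Lemma entryDZ a f g c i j :
  entry (a *: f + g) c i j = a * entry f c i j + entry g c i j.
Proof.
by rewrite /entry (fsDZ (V := mat_infty K)) (fsDZ (V := K^o)).
Qed.

Lemma entry0 c i j : entry 0 c i j = 0.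
Proof. by []. Qed.

Lemma entry_unit c i j c' i' j' :
  entry (unit_mx c i j) c' i' j' = ((c' == c) && ((i' == i) && (j' == j)))%:R.
Proof.
rewrite /entry /unit_mx /=; case: (c' == c) => //=.
by rewrite xpair_eqE; case: ifP.
Qed.

Lemma mat_mulf1 (A B : fsfunc (nat * nat) K^o) i l m :
  (forall n, n != m -> A (i, n) * B (n, l) = 0) ->
  mat_mulf A B (i, l) = A (i, m) * B (m, l).
Proof.
move=> AB0; rewrite /mat_mulf /= -(fsbig_widen [set m]) ?fsbig_set1 //.
by move=> n [_ /= /eqP nm]; exact: AB0.
Qed.

Lemma entry_unit_mul c i j f c' i' l :
  entry (nmul (unit_mx c i j) f) c' i' l
    = if (c' == c) && (i' == i) then entry f c j l else 0.
Proof.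
have E : entry (nmul (unit_mx c i j) f) c' i' l = 
    entry (unit_mx c i j) c' i' j * entry f c' j l.
  apply: (@mat_mulf1 (unit_mx c i j c' : fsfunc _ _)) => n nj.
  rewrite -[X in X * _]/(entry (unit_mx c i j) c' i' n) entry_unit.
  by rewrite (negPf nj) !andbF mul0r.
rewrite {}E entry_unit eqxx andbT.
by have [->|] := eqVneq c' c; case: eqP => //=; rewrite ?mul1r ?mul0r.
Qed.

Lemma dsum_support f : exists s : seq (C * (nat * nat)),
  forall c i j, entry f c i j != 0 -> (c, (i, j)) \in s.
Proof.
have F : finite_set (\bigcup_(c in [set c | f c != 0])
    (pair c @` [set p | (f c : fsfunc (nat * nat) K^o) p != 0])).
  apply: bigcup_finite; first exact: fs_finite.
  by move=> c _; apply: finite_image; exact: fs_finite.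
have /finite_seqP[s sE] := F; exists s => c i j fij.
suff : [set` s] (c, (i, j)) by [].
rewrite -sE; exists c; last by exists (i, j).
by apply: contraNN fij => /eqP fc; rewrite /entry fc.
Qed.

(** Induction on a list that contains the support: subtracting one term removes
    one position from the support. *)
Lemma dsum_span f : lin_span [set t | exists c i j, t = unit_mx c i j] f.
Proof.
have [s] := dsum_support f; elim: s f => [|[c [i j]] s IH] f supp.
  suff -> : f = 0 by exact: span0.
  apply: entry_inj => c i j; rewrite entry0; apply/eqP; apply: contraT => fij.
  by have := supp _ _ _ fij.
pose a := entry f c i j; pose g : D := - a *: unit_mx c i j + f.
have gE : f = a *: unit_mx c i j + g by rewrite addrA scaleNr addrN add0r.
rewrite gE; constructor; first by exists c, i, j.
apply: IH => c' i' j'; rewrite /g entryDZ entry_unit.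
have := supp c' i' j'; rewrite in_cons !xpair_eqE.
have [E|_] := boolP (_ && _); last by rewrite mulr0 add0r.
by move: E => /and3P[/eqP-> /eqP-> /eqP->]; rewrite mulr1 addNr eqxx.
Qed.

End StandardUnits.

(** The multiplication table of the standard matrix units of a direct sum of
    matrix algebras, one block for each [c], together with spanning. *)
Record matrix_units (K : fieldType) (C : choiceType) (A : nualg K)
    (u : C -> nat -> nat -> A) : Prop := MatrixUnits {
  mu_neq0 : forall c i j, u c i j <> 0;
  mu_mul : forall c i j l, nmul (u c i j) (u c j l) = u c i l;
  mu_mul0 : forall c c' i j k l, (c, j) <> (c', k) ->
    nmul (u c i j) (u c' k l) = 0;
  mu_span : forall a, lin_span [set t | exists c i j, t = u c i j] a }.

Lemma standard_units (K : fieldType) (C : choiceType) :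
  matrix_units (@unit_mx K C).
Proof.
split=> [c i j /(congr1 (fun f => entry f c i j))|c i j l|c c' i j k l n|].
- by rewrite entry_unit entry0 !eqxx => /eqP; rewrite oner_eq0.
- apply: entry_inj => c' i' l'; rewrite entry_unit_mul !entry_unit !eqxx /=.
  by case: eqP => //=; case: eqP.
- apply: entry_inj => d i' l'; rewrite entry_unit_mul entry_unit entry0.
  case: ifP => // _; case: eqP => //= e; case: eqP => //= e'.
  by case: n; rewrite e e'.
- exact: dsum_span.
Qed.

Lemma matrix_units_iso (K : fieldType) (C : choiceType) (A B : nualg K)
    (u : C -> nat -> nat -> A) :
  matrix_units u -> nualg_iso B A ->
  exists v : C -> nat -> nat -> B, matrix_units v.
Proof.
move=> uM [f [flin fmul] [g fK gK]].
pose F := GRing.isLinear.Build K B A *:%R f flin.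
pose f' : {linear B -> A} := HB.pack f F.
have f0 : f 0 = 0 by exact: (raddf0 f').
have gmul a b : nmul (g a) (g b) = g (nmul a b).
  by apply: (can_inj fK); rewrite fmul !gK.
exists (fun c i j => g (u c i j)); split.
- move=> c i j /(congr1 f); rewrite gK f0; exact: mu_neq0.
- by move=> c i j l; rewrite gmul (mu_mul uM).
- by move=> c c' i j k l n; rewrite gmul (mu_mul0 uM) // -[0]f0 fK.
- move=> a; rewrite -[a]fK; elim: (mu_span uM (f a)) => [|c x y].
    by rewrite -f0 fK; exact: span0.
  move=> [d [i [j ->]]] _ IH; have -> : g (c *: u d i j + y) = c *: g (u d i j) + g y.
    by apply: (can_inj fK); rewrite flin !gK.
  by constructor=> //; exists d, i, j.
Qed.

Section UnitsToDirectSum.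
Variables (K : fieldType) (C : choiceType) (A : nualg K).
Variables (u : C -> nat -> nat -> A) (uM : matrix_units u).
Local Notation D := (direct_sum C (mat_infty K)).

(** A sum over all positions, of which finitely many contribute: it is the
    inverse of the isomorphism [matrix_units_dsum]. *)
Definition from_dsum (f : D) : A :=
  \sum_(t \in [set: C * (nat * nat)]) entry f t.1 t.2.1 t.2.2 *: u t.1 t.2.1 t.2.2.

Lemma from_dsumE (f : D) (s : {fset C * (nat * nat)}) :
  (forall c i j, entry f c i j != 0 -> (c, (i, j)) \in s) ->
  from_dsum f = \sum_(t <- s) entry f t.1 t.2.1 t.2.2 *: u t.1 t.2.1 t.2.2.
Proof.
move=> fs; apply: fsbigTE => -[c [i j]] /= ts.
have [->|/fs] := eqVneq (entry f c i j) 0; first by rewrite scale0r.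
by rewrite (negPf ts).
Qed.

Lemma from_dsum_linear : linear from_dsum.
Proof.
move=> a f g; have [s fs] := dsum_support f; have [r gr] := dsum_support g.
pose q := [fset t in s ++ r]%fset.
have fq c i j : entry f c i j != 0 -> (c, (i, j)) \in q.
  by move=> /fs; rewrite in_fset mem_cat => ->.
have gq c i j : entry g c i j != 0 -> (c, (i, j)) \in q.
  by move=> /gr; rewrite in_fset mem_cat => ->; rewrite orbT.
rewrite (from_dsumE fq) (from_dsumE gq) (@from_dsumE _ q).
  rewrite scaler_sumr -big_split /=; apply: eq_bigr => t _.
  by rewrite entryDZ scalerDl scalerA.
move=> c i j; rewrite entryDZ; apply: contraNT => nq.
have [->|/fq] := eqVneq (entry f c i j) 0; last by rewrite (negPf nq).
have [->|/gq] := eqVneq (entry g c i j) 0; last by rewrite (negPf nq).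
by rewrite mulr0 addr0.
Qed.

Lemma from_dsum_unit c i j : from_dsum (unit_mx K c i j) = u c i j.
Proof.
rewrite (@from_dsumE _ [fset (c, (i, j))]%fset).
  by rewrite big_seq_fset1 /= entry_unit !eqxx scale1r.
move=> c' i' j'; rewrite entry_unit inE !xpair_eqE.
by case: (_ && _) => //; rewrite eqxx.
Qed.

Lemma from_dsum0 : from_dsum 0 = 0.
Proof. by apply: fsbig1 => t _; rewrite entry0 scale0r. Qed.

(** Both sides are bilinear, and they agree on matrix units. *)
Lemma from_dsum_mul : {morph from_dsum : f g / nmul f g}.
Proof.
move=> f g; have flin := from_dsum_linear.
elim: (dsum_span f) => [|a x y [c [i [j ->]]] _ IH].
  by rewrite nmul0l from_dsum0 nmul0l.
rewrite nmulDl -nscaleAl !flin nmulDl -nscaleAl IH; congr (_ *: _ + _).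
elim: (dsum_span g) => [|b z t [d [k [l ->]]] _ IH'].
  by rewrite nmul0r from_dsum0 nmul0r.
rewrite nmulDr -nscaleAr !flin nmulDr -nscaleAr IH' !from_dsum_unit.
congr (_ *: _ + _); have [[-> ->]|ne] := pselect ((c, j) = (d, k)).
  by rewrite (mu_mul (standard_units K C)) from_dsum_unit (mu_mul uM).
by rewrite (mu_mul0 (standard_units K C)) // (mu_mul0 uM) // from_dsum0.
Qed.

(** The coefficients of an element are recovered by cutting out corners; this
    makes [from_dsum] injective. *)
Lemma units_pinch f c i j :
  nmul (nmul (u c i i) (from_dsum f)) (u c j j) = entry f c i j *: u c i j.
Proof.
elim: (dsum_span f) => [|a x y [d [k [l ->]]] _ IH].
  by rewrite from_dsum0 nmul0r nmul0l entry0 scale0r.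
rewrite from_dsum_linear nmulDr nmulDl IH entryDZ scalerDl; congr (_ + _).
rewrite -nscaleAr -nscaleAl from_dsum_unit entry_unit -scalerA; congr (_ *: _).
have [[<- <-]|ne] := pselect ((c, i) = (d, k)); last first.
  rewrite (mu_mul0 uM) // nmul0l; case: eqP => [e|]; last by rewrite scale0r.
  case: eqP => [e'|]; last by rewrite scale0r.
  by case: ne; rewrite e e'.
rewrite !eqxx (mu_mul uM) /=; have [<-|ne] := eqVneq j l.
  by rewrite (mu_mul uM) scale1r.
by rewrite (mu_mul0 uM) ?scale0r // => -[e]; case/eqP: ne.
Qed.

Lemma from_dsum_inj : injective from_dsum.
Proof.
move=> f g fg; apply: entry_inj => c i j.
have := units_pinch f c i j; rewrite fg units_pinch => /eqP.
rewrite -subr_eq0 -scalerBl scaler_eq0 subr_eq0 => /orP[/eqP //|/eqP].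
by move/(mu_neq0 uM).
Qed.

Lemma from_dsum_surj a : exists f, from_dsum f = a.
Proof.
elim: (mu_span uM a) => [|c x y [d [i [j ->]]] _ [g <-]].
  by exists 0; exact: from_dsum0.
exists (c *: unit_mx K d i j + g).
by rewrite from_dsum_linear from_dsum_unit.
Qed.

Lemma matrix_units_dsum : nualg_iso A D.
Proof.
pose g a := sval (cid (from_dsum_surj a)).
have gK a : from_dsum (g a) = a by rewrite /g; case: cid.
have fK : cancel from_dsum g by move=> f; apply: from_dsum_inj; rewrite gK.
exists g; last by exists from_dsum.
split=> [c a b|a b]; apply: from_dsum_inj.
  by rewrite from_dsum_linear !gK.
by rewrite from_dsum_mul !gK.
Qed.

(** Takes the place of a unit: an element whose corners all vanish is zero. *)
Lemma units_nondegenerate (a : A) : a <> 0 -> exists c i j (x : K),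
  x != 0 /\ nmul (nmul (u c i i) a) (u c j j) = x *: u c i j.
Proof.
have [f <-] := from_dsum_surj a => f0.
have [//|] := pselect (exists c i j, entry f c i j != 0).
  by move=> [c [i [j fij]]]; exists c, i, j, (entry f c i j); rewrite units_pinch.
move=> nex; case: f0; rewrite (_ : f = 0) ?from_dsum0 //.
apply: entry_inj => c i j; rewrite entry0; apply/eqP; apply: contraT => fij.
by case: nex; exists c, i, j.
Qed.

End UnitsToDirectSum.
(** * An algebra spanned by matrix units is semisimple *)

Section SemisimpleFromUnits.
Variables (K : fieldType) (C : choiceType) (A : nualg K).
Variables (u : C -> nat -> nat -> A) (uM : matrix_units u).

(** A nonzero [a] with [a * u c j j = a] has its nonzero corners in column [j]
    of block [c], hence some [u c j i * a] is a nonzero multiple of [u c j j]. *)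
Lemma left_ideal_unit (J : set A) (a : A) c j : left_ideal J -> J a -> a <> 0 ->
  nmul a (u c j j) = a -> J (u c j j).
Proof.
move=> [_ JM] Ja a0 au.
have [d [i [k [x [x0 xE]]]]] := units_nondegenerate uM a0.
have [[e e']|ne] := pselect ((c, j) = (d, k)); last first.
  move: xE; rewrite -au -!nmulA (mu_mul0 uM _ _ ne) !nmul0r => /esym/eqP.
  by rewrite scaler_eq0 (negPf x0) /= => /eqP /(mu_neq0 uM).
move: xE; rewrite -e -e' -nmulA au => xE.
suff <- : nmul (x^-1 *: u c j i) (nmul (u c i i) a) = u c j j by apply/JM/JM.
by rewrite xE -nscaleAl -nscaleAr scalerA mulVf // scale1r (mu_mul uM).
Qed.

Lemma units_minimal c j :
  minimal_left_ideal [set a : A | nmul a (u c j j) = a].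
Proof.
split.
- split; first (split=> [|a b /= ea eb]; rewrite /= ?nmul0l //).
    by rewrite nmulBl ea eb.
  by move=> a b /= eb; rewrite -nmulA eb.
- move=> /seteqP[/(_ (u c j j)) /= + _]; rewrite (mu_mul uM) => /(_ erefl).
  exact: mu_neq0.
- move=> J JI JL; have [[J0 _] JM] := JI.
  have [[a [Ja a0]]|nex] := pselect (exists a, J a /\ a <> 0).
    right; apply/seteqP; split=> // b /= <-; apply: JM.
    exact: left_ideal_unit JI Ja a0 (JL _ Ja).
  left; apply/seteqP; split=> [a Ja|_ -> //]; apply: contrapT => a0.
  by apply: nex; exists a.
Qed.

Lemma semiprime_from_units : semiprime A.
Proof.
move=> I [[[I0 IB] IM] IMr] II0; apply/seteqP; split=> [a Ia|_ -> //].
apply: contrapT => a0; have [c [i [j [x [x0 xE]]]]] := units_nondegenerate uM a0.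
have Iu : I (u c j j).
  suff <- : nmul (x^-1 *: u c j i) (nmul (nmul (u c i i) a) (u c j j)) = u c j j.
    by apply/IM/IMr/IM.
  by rewrite xE -nscaleAl -nscaleAr scalerA mulVf // scale1r (mu_mul uM).
by have := II0 _ _ Iu Iu; rewrite (mu_mul uM); exact: mu_neq0.
Qed.

Lemma semisimple_from_units : semisimple A.
Proof.
split; first exact: semiprime_from_units.
apply/seteqP; split=> // a _; elim: (mu_span uM a) => [|x b r].
  by exists [::]; rewrite // big_nil.
move=> [c [i [j ->]]] _ [s sm ->].
exists (x *: u c i j :: s); last by rewrite big_cons.
move=> b'; rewrite in_cons => /predU1P[->|/sm //].
exists [set a : A | nmul a (u c j j) = a]; first exact: units_minimal.
by rewrite /= -nscaleAl (mu_mul uM).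
Qed.

End SemisimpleFromUnits.

(** * Chains of left ideals inside a finite sum of minimal left ideals *)

Section FiniteLength.
Variables (K : fieldType) (A : nualg K).
Implicit Types (J S T : set A).

Definition ideal_add S T : set A :=
  [set a | exists b c, [/\ S b, T c & a = b + c]].

Fixpoint ideal_sum (s : seq (set A)) : set A :=
  if s is T :: s' then ideal_add T (ideal_sum s') else [set 0].

Lemma left_idealD J a b : left_ideal J -> J a -> J b -> J (a + b).
Proof.
move=> [[J0 JB] _] Ja Jb; rewrite -[b]opprK -[- b]sub0r; exact/JB/JB.
Qed.

Lemma left_ideal_add S T : left_ideal S -> left_ideal T ->
  left_ideal (ideal_add S T).
Proof.
move=> [[S0 SB] SM] [[T0 TB] TM]; split; first split.
- by exists 0, 0; rewrite addr0.
- move=> _ _ [a [b [Sa Tb ->]]] [c [d [Sc Td ->]]].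
  by exists (a - c), (b - d); split; [exact: SB|exact: TB|rewrite opprD addrACA].
- move=> a _ [b [c [Sb Tc ->]]]; exists (nmul a b), (nmul a c).
  by split; [exact: SM|exact: TM|exact: nmulDr].
Qed.

Lemma left_idealI S T : left_ideal S -> left_ideal T -> left_ideal (S `&` T).
Proof.
move=> [[S0 SB] SM] [[T0 TB] TM]; split=> [|a b [Sb Tb]]; last first.
  by split; [exact: SM|exact: TM].
by split=> // a b [Sa Ta] [Sb Tb]; split; [exact: SB|exact: TB].
Qed.

Lemma ideal_sum_left s :
  (forall S, S \in s -> left_ideal S) -> left_ideal (ideal_sum s).
Proof.
elim: s => [|S s IH] sL /=.
  split; first by split=> // a b -> ->; rewrite subrr.
  by move=> a b ->; rewrite /= nmul0r.
apply: left_ideal_add; first by apply: sL; rewrite mem_head.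
by apply: IH => T Ts; apply: sL; rewrite in_cons Ts orbT.
Qed.

(** A weak form of the Jordan-Hoelder bound, by induction on the number of
    summands.  Let [T] be the sum of all summands but the first, [S].  As long as
    [J i] stays inside [T] the induction hypothesis applies; from the first [m] for
    which [J m] leaves [T] onwards, minimality of [S] gives [S] inside [J i + T],
    and then [J i] is determined by its intersection with [T].  Splicing the two
    regimes gives a chain inside [T] that is one step shorter. *)
Lemma chain_stationary (s : seq (set A)) (J : nat -> set A) :
  (forall S, S \in s -> minimal_left_ideal S) ->
  (forall i, left_ideal (J i)) -> (forall i, J i `<=` J i.+1) ->
  (forall i, J i `<=` ideal_sum s) ->
  exists2 i, (i <= size s)%N & J i = J i.+1.
Proof.
elim: s J => [|S s IH] J sm JI Jinc Jsub.
  exists 0%N => //; apply/seteqP; split=> [|a /Jsub ->]; first exact: Jinc.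
  by case: (JI 0%N) => -[].
have SM : minimal_left_ideal S by apply: sm; rewrite mem_head.
have sm' T : T \in s -> minimal_left_ideal T.
  by move=> Ts; apply: sm; rewrite in_cons Ts orbT.
have TI : left_ideal (ideal_sum s).
  by apply: ideal_sum_left => T /sm' [].
set T := ideal_sum s in TI *.
have Jmono i j : (i <= j)%N -> J i `<=` J j.
  move=> /subnK <-; elim: (j - i)%N => // n IHn a /IHn; exact: Jinc.
have IHT := IH ^~ sm'.
have [inT|] := pselect (forall i, (i <= (size s).+1)%N -> J i `<=` T).
  have [|||i si] := IHT (fun i => J (minn i (size s).+1)) => //.
  - move=> i; apply: Jmono; rewrite leq_min geq_minr andbT.
    by rewrite (leq_trans (geq_minl _ _)).
  - by move=> i; apply: inT; exact: geq_minr.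
  by rewrite (minn_idPl (leqW si)) (minn_idPl _) //; exists i => //; exact: leqW.
move=> /existsNP[m0 /not_implyP[m0s m0T]].
have [m /asboolP mT mmin] : {m | `[< ~ (J m `<=` T) >]
    & forall n, `[< ~ (J n `<=` T) >] -> (m <= n)%N}.
  have ex : exists m, `[< ~ (J m `<=` T) >] by exists m0; apply/asboolP.
  by exists (ex_minn ex); case: ex_minnP.
have ms : (m <= (size s).+1)%N by apply: leq_trans (mmin _ _) m0s; apply/asboolP.
have JT n : (n < m)%N -> J n `<=` T.
  by rewrite ltnNge => nm; apply: contrapT => /asboolP /mmin; apply/negP.
have full i : (m <= i)%N -> S `<=` ideal_add (J i) T.
  move=> mi; case: SM => SI _ Smin.
  case: (Smin (S `&` ideal_add (J i) T)) => [||e|<- a [] //].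
  - by apply: left_idealI => //; exact: left_ideal_add.
  - by move=> a [].
  case: mT => a /(Jmono _ _ mi) Jia; have [b [c [Sb Tc ab]]] := Jsub _ _ Jia.
  suff b0 : b = 0 by rewrite ab b0 add0r.
  suff : (S `&` ideal_add (J i) T) b by rewrite e.
  split=> //; exists a, (- c); split=> //; last by rewrite ab addrK.
  by case: TI => -[T0 TB] _; rewrite -sub0r; exact: TB.
have step i : (m <= i)%N -> J i `&` T = J i.+1 `&` T -> J i = J i.+1.
  move=> mi e; apply/seteqP; split=> [|a Ja]; first exact: Jinc.
  have [b [c [Sb Tc ab]]] := Jsub _ _ Ja.
  have [d [t [Jd Tt bd]]] := full _ mi _ Sb.
  have : (J i `&` T) (a - d).
    rewrite e; split; first by have [[_ JB] _] := JI i.+1; apply: JB => //; exact: Jinc.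
    have -> : a - d = t + c by rewrite ab bd -(addrA d) [d + _]addrC addrK.
    exact: left_idealD.
  by move=> [Jad _]; rewrite -(subrK d a); exact: left_idealD.
pose J' i := if (i < m)%N then J i else J i.+1 `&` T.
have [|||i si] := IHT J'.
- move=> i; rewrite /J'; case: ifP => _; first exact: JI.
  by apply: left_idealI; first exact: JI.
- move=> i; rewrite /J' /=; case: (ltnP i m) => im; case: ltnP => im' // a Ja.
  + by split; [exact/Jinc/Jinc|exact: JT Ja].
  + by case: Ja => Ja Ta; split=> //; exact: Jinc.
- move=> i; rewrite /J'; case: ifP => im a; first exact: JT.
  by case.
rewrite /J'; case: (ltnP i m) => im; case: ltnP => im' e.
- by exists i => //; exact: leqW.
- have mi : m = i.+1 by apply/eqP; rewrite eqn_leq im im'.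
  exists i.+1 => //; apply: step; first by rewrite mi.
  apply/seteqP; split=> a [Ja Ta]; split=> //; first exact: Jinc.
  by apply: Jinc; rewrite e.
- by rewrite ltnNge leqW in im'.
- by exists i.+1 => //; apply: step; first exact: leqW.
Qed.

End FiniteLength.
(** * Degrees, prefixes and infinite paths *)

Section Degrees.
Variable k : nat.
Implicit Types m n p : degree k.

Definition ones (j : nat) : degree k := [ffun=> j].

Lemma onesE j i : ones j i = j.
Proof. by rewrite ffunE. Qed.

Lemma ones_add i j : ones (i + j) = ones i + ones j.
Proof. by apply/ffunP => a; rewrite addkE !onesE. Qed.

Lemma ones_cofinal n : exists j, lek n (ones j).
Proof.
exists (\max_i n i); apply/forallP => i; rewrite onesE.
exact: (@leq_bigmax _ (fun i => n i)).
Qed.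

Lemma lek_ones i j : (i <= j)%N -> lek (ones i) (ones j).
Proof. by move=> ij; apply/forallP => a; rewrite !onesE. Qed.

Lemma lek0 n : lek 0 n.
Proof. by apply/forallP => i; rewrite ffunE. Qed.

Lemma lekP m n : reflect (exists p, n = m + p) (lek m n).
Proof.
apply: (iffP idP) => [mn|[p ->]]; last exact: lek_addr.
by exists (subk n m); rewrite subkK.
Qed.

Lemma addkI m : injective (+%R m : degree k -> degree k).
Proof. by move=> n p e; rewrite -(addkK m n) e addkK. Qed.

Lemma addIk m : injective (fun n : degree k => n + m).
Proof. by move=> n p /=; rewrite ![_ + m]addrC => /addkI. Qed.

Lemma degree_neq_coord m n : m <> n -> exists i, m i <> n i.
Proof. by move=> mn; apply/existsNP => mE; apply/mn/ffunP. Qed.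

End Degrees.

Section Paths.
Variables (k : nat) (L : kgraph k).
Implicit Types (l m a b c : kpath L) (v w : kvert L) (n p : degree k).
Implicit Types x y z : infpath L.

(** Unique factorization is used through this cancellation rule. *)
Lemma kcomp_inj a b a' b' : src a = rng b -> src a' = rng b' ->
  deg a = deg a' -> kcomp a b = kcomp a' b' -> a = a' /\ b = b'.
Proof.
move=> ab ab' da e.
have db : deg b = deg b'.
  by apply: (@addkI _ (deg a)); rewrite -deg_comp // e deg_comp // da.
have [p [_ puniq]] := factorization (deg_comp ab).
have e1 : p = (a, b) by apply: puniq.
have e2 : p = (a', b') by apply: puniq; split; rewrite /= ?da ?db.
by move: e1; rewrite e2 => -[-> ->].
Qed.

Lemma deg0_kid l : deg l = 0 -> l = kid (rng l).
Proof.
move=> d0; have [] // := @kcomp_inj l (kid (src l)) (kid (rng l)) l.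
- by rewrite rng_id.
- by rewrite src_id.
- by rewrite deg_id.
- by rewrite comp_idr comp_idl.
Qed.

(** The order given by factorization on the left.  The prefixes of a path are
    determined by their degrees, which reduces most facts on infinite paths to
    comparing degrees. *)
Definition path_prefix a c : Prop := exists b, src a = rng b /\ c = kcomp a b.

Lemma path_prefix_refl a : path_prefix a a.
Proof. by exists (kid (src a)); rewrite rng_id comp_idr. Qed.

Lemma path_prefix_trans a b c : path_prefix a b -> path_prefix b c -> path_prefix a c.
Proof.
move=> [d [ad ->]] [e [be ->]]; rewrite src_comp // in be.
by exists (kcomp d e); rewrite rng_comp // Defs.compA.
Qed.

Lemma path_prefix_rng a c : path_prefix a c -> rng c = rng a.
Proof. by move=> [b [ab ->]]; rewrite rng_comp. Qed.

Lemma path_prefix_deg a c : path_prefix a c -> lek (deg a) (deg c).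
Proof. by move=> [b [ab ->]]; rewrite deg_comp // lek_addr. Qed.

Lemma path_prefix_eq a b c : path_prefix a c -> path_prefix b c -> deg a = deg b -> a = b.
Proof.
by move=> [d [ad ->]] [e [be ce]] dd; have [] := kcomp_inj ad be dd ce.
Qed.

Lemma path_prefix_exists c n : lek n (deg c) -> exists a, path_prefix a c /\ deg a = n.
Proof.
move=> /lekP[p /factorization[[a b] [[/= ab da _ cE] _]]].
by exists a; split=> //; exists b.
Qed.

Lemma path_prefix_le a b c : path_prefix a c -> path_prefix b c -> lek (deg a) (deg b) ->
  path_prefix a b.
Proof.
move=> ac bc /path_prefix_exists[a' [a'b da]].
by rewrite (path_prefix_eq ac (path_prefix_trans a'b bc) (esym da)).
Qed.

Definition init x n : kpath L := fmor x (exist _ (0, n) (lek0 n) : omega_path k).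

Arguments init : simpl never.
Arguments inf_vertex : simpl never.

Lemma deg_init x n : deg (init x n) = n.
Proof.
rewrite /init fmor_deg; apply/ffunP => i; rewrite ffunE /=.
by rewrite /omega_rng /omega_src /= ffunE subn0.
Qed.

Lemma rng_init x n : rng (init x n) = inf_vertex x 0.
Proof. exact: fmor_rng. Qed.

Lemma src_init x n : src (init x n) = inf_vertex x n.
Proof. exact: fmor_src. Qed.

Lemma inf_vertex_shift p x n : inf_vertex (shift p x) n = inf_vertex x (n + p).
Proof. by []. Qed.

Lemma init_add x n p : init x (n + p) = kcomp (init x n) (init (shift n x) p).
Proof.
rewrite /init /= -fmor_comp; last by rewrite /= /omega_rng /omega_src /= add0r.
congr (fmor x _); apply: omegaP.
  by rewrite omega_rng_comp //= /omega_rng /omega_src /= add0r.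
rewrite omega_src_comp; last by rewrite /omega_rng /omega_src /= add0r.
by rewrite /omega_rng /omega_src /= addrC.
Qed.

Lemma path_prefix_init x n p : lek n p -> path_prefix (init x n) (init x p).
Proof.
move=> /lekP[q ->]; exists (init (shift n x) q).
by rewrite src_init rng_init inf_vertex_shift add0r init_add.
Qed.

Lemma shift_shift n p x : shift n (shift p x) = shift (n + p) x.
Proof.
apply: kfunctorP => e /=; congr (fmor x _); apply: omegaP;
by rewrite /omega_rng /omega_src /= addrA.
Qed.

Lemma shift0 x : shift 0 x = x.
Proof.
apply: kfunctorP => e /=; congr (fmor x _); apply: omegaP;
by rewrite /omega_rng /omega_src /= addr0.
Qed.

Lemma shiftC n p x : shift n (shift p x) = shift p (shift n x).
Proof. by rewrite !shift_shift addrC. Qed.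

(** An infinite path is determined by its initial segments along a cofinal
    sequence of degrees; the segment between two degrees is found by cancellation. *)
Lemma init_inj x y : (forall j, init x (ones k j) = init y (ones k j)) -> x = y.
Proof.
move=> xy.
have {}xy n : init x n = init y n.
  have [j nj] := ones_cofinal n.
  apply: path_prefix_eq (path_prefix_init x nj) _ _; last by rewrite !deg_init.
  by rewrite xy; exact: path_prefix_init.
apply: kfunctorP => e.
have decomp z : init z (omega_src e) = kcomp (init z (omega_rng e)) (fmor z e).
  rewrite /init -fmor_comp //; congr (fmor z _); apply: omegaP.
    by rewrite omega_rng_comp.
  by rewrite omega_src_comp.
have [] // := @kcomp_inj (init x (omega_rng e)) (fmor x e)
  (init y (omega_rng e)) (fmor y e).
- by rewrite src_init fmor_rng.
- by rewrite src_init fmor_rng.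
- by rewrite !deg_init.
- by rewrite -!decomp.
Qed.

(** The segment from [m] to [n] is what remains of [P n] after [P m];
    functoriality is uniqueness of that remainder. *)
Lemma infpath_of_prefixes (P : degree k -> kpath L) :
  (forall n, deg (P n) = n) -> (forall n p, path_prefix (P n) (P (n + p))) ->
  exists x, forall n, init x n = P n.
Proof.
move=> Pdeg Pinc.
have rest (e : omega_path k) : exists b,
    src (P (omega_rng e)) = rng b /\ P (omega_src e) = kcomp (P (omega_rng e)) b.
  by have := Pinc (omega_rng e) (omega_deg e); rewrite subkK ?(valP e).
have [f fP] := choice rest.
have frng e : rng (f e) = src (P (omega_rng e)) by have [-> _] := fP e.
have fsrc e : src (f e) = src (P (omega_src e)).
  by have [fr ->] := fP e; rewrite src_comp.
have funiq e b : src (P (omega_rng e)) = rng b ->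
    P (omega_src e) = kcomp (P (omega_rng e)) b -> f e = b.
  have [er ->] := fP e => br eb.
  by have [] := kcomp_inj er br erefl eb.
have fid n : f (omega_id n) = kid (src (P n)).
  by apply: funiq; rewrite ?rng_id // comp_idr.
have fcomp (e e' : omega_path k) : omega_src e = omega_rng e' ->
    f (omega_comp e e') = kcomp (f e) (f e').
  move=> ee'; have ff : src (f e) = rng (f e') by rewrite fsrc frng ee'.
  apply: funiq; rewrite omega_rng_comp // ?omega_src_comp //.
    by rewrite rng_comp // frng.
  rewrite Defs.compA ?frng //; last by rewrite fsrc ee'.
  by have [_ <-] := fP e; rewrite ee'; have [] := fP e'.
have fdeg e : deg (f e) = omega_deg e.
  have [er es] := fP e; apply: (@addkI _ (omega_rng e)).
  by rewrite -{1}[omega_rng e]Pdeg -deg_comp // -es Pdeg subkK //; exact: (valP e).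
exists (@KFunctor k (Omega k) L (fun n => src (P n)) f frng fsrc fid fcomp fdeg).
have P0 n : P 0 = kid (rng (P n)).
  by rewrite -[n in RHS]add0r (path_prefix_rng (Pinc 0 n)) -(deg0_kid (Pdeg 0)).
move=> n; apply: funiq => /=; rewrite /omega_rng /omega_src /= (P0 n) ?src_id //.
by rewrite comp_idl.
Qed.

(** All initial segments can be read off from a sequence of longer and longer
    paths whose degrees are cofinal. *)
Lemma infpath_of_chain (Q : nat -> kpath L) :
  (forall j, path_prefix (Q j) (Q j.+1)) -> (forall j, lek (ones k j) (deg (Q j))) ->
  exists x, forall n j, lek n (deg (Q j)) -> path_prefix (init x n) (Q j).
Proof.
move=> Qinc Qdeg.
have Qmono i j : (i <= j)%N -> path_prefix (Q i) (Q j).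
  move=> /subnK <-; elim: (j - i)%N => [|d IH]; first exact: path_prefix_refl.
  exact: path_prefix_trans IH (Qinc _).
have take n : exists a, deg a = n /\ exists j, path_prefix a (Q j).
  have [j nj] := ones_cofinal n.
  have [a [aQ da]] := path_prefix_exists (lek_trans nj (Qdeg j)).
  by exists a; split=> //; exists j.
have [P PP] := choice take.
have Pdeg n : deg (P n) = n by case: (PP n).
have PQ n j : lek n (deg (Q j)) -> path_prefix (P n) (Q j).
  move=> nj; have [_ [i Pi]] := PP n; have [ij|/ltnW ji] := leqP i j.
    exact: path_prefix_trans Pi (Qmono _ _ ij).
  by apply: path_prefix_le Pi (Qmono _ _ ji) _; rewrite Pdeg.
have [|x xP] := infpath_of_prefixes Pdeg.
  move=> n p; have [_ [j Pj]] := PP (n + p).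
  have np : lek n (deg (Q j)).
    apply: lek_trans (lek_addr n p) _; rewrite -[n + p]Pdeg; exact: path_prefix_deg.
  by apply: path_prefix_le (PQ _ _ np) Pj _; rewrite !Pdeg lek_addr.
by exists x => n j; rewrite xP; exact: PQ.
Qed.

(** The paths [l x(0,n)] form a chain with cofinal degrees. *)
Lemma prepend_exists l x : src l = inf_vertex x 0 ->
  exists y, init y (deg l) = l /\ shift (deg l) y = x.
Proof.
move=> lx; pose Q j := kcomp l (init x (ones k j)).
have lr n : src l = rng (init x n) by rewrite rng_init.
have Qdeg j : deg (Q j) = deg l + ones k j by rewrite deg_comp // deg_init.
have [j|j|y yQ] := @infpath_of_chain Q.
- have [b [ab e]] := path_prefix_init x (lek_ones k (leqnSn j)).
  exists b; rewrite src_comp //; split=> //.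
  by rewrite /Q e Defs.compA.
- by rewrite Qdeg addrC lek_addr.
have yl : init y (deg l) = l.
  have := yQ (deg l) 0%N; rewrite Qdeg lek_addr => /(_ isT) yl.
  by apply: path_prefix_eq yl _ _; [exists (init x (ones k 0))|rewrite deg_init].
exists y; split=> //; apply: init_inj => j.
have := yQ (deg (Q j)) j (lek_refl _) => yj.
have := path_prefix_eq yj (path_prefix_refl _) (deg_init _ _).
rewrite Qdeg init_add yl => /(kcomp_inj _ (lr _) erefl)[] //.
by rewrite rng_init inf_vertex_shift add0r -src_init yl.
Qed.

Lemma prepend_unique n x y : init x n = init y n -> shift n x = shift n y -> x = y.
Proof.
move=> ixy sxy; apply: init_inj => j.
have le z : path_prefix (init z (ones k j)) (init z (n + ones k j)).
  by apply: path_prefix_init; rewrite addrC lek_addr.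
by apply: path_prefix_eq (le x) _ _; rewrite ?deg_init // init_add ixy sxy -init_add.
Qed.

(** A total function, so that it can be precomposed with in the operators below;
    when [l] and [x] do not fit together the default value is [x]. *)
Definition prepend l x : infpath L :=
  if pselect (src l = inf_vertex x 0) is left e then sval (cid (prepend_exists e))
  else x.

Lemma prependP l x : src l = inf_vertex x 0 ->
  init (prepend l x) (deg l) = l /\ shift (deg l) (prepend l x) = x.
Proof. by move=> e; rewrite /prepend; case: pselect => // e'; case: cid. Qed.

Lemma init_prepend l x : src l = inf_vertex x 0 -> init (prepend l x) (deg l) = l.
Proof. by case/prependP. Qed.

Lemma shift_prepend l x : src l = inf_vertex x 0 -> shift (deg l) (prepend l x) = x.
Proof. by case/prependP. Qed.

Lemma init_shiftK n x : prepend (init x n) (shift n x) = x.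
Proof.
have e : src (init x n) = inf_vertex (shift n x) 0.
  by rewrite src_init inf_vertex_shift add0r.
have := init_prepend e; have := shift_prepend e; rewrite deg_init => s i.
exact: prepend_unique i s.
Qed.

Lemma prepend_vertex0 l x : src l = inf_vertex x 0 -> inf_vertex (prepend l x) 0 = rng l.
Proof. by move=> e; rewrite -(rng_init _ (deg l)) init_prepend. Qed.

Lemma prepend_comp l m x : src l = rng m -> src m = inf_vertex x 0 ->
  prepend (kcomp l m) x = prepend l (prepend m x).
Proof.
move=> lm mx.
have e1 : src (kcomp l m) = inf_vertex x 0 by rewrite src_comp.
have e2 : src l = inf_vertex (prepend m x) 0 by rewrite prepend_vertex0.
apply: (@prepend_unique (deg (kcomp l m))).
  rewrite init_prepend // deg_comp // init_add init_prepend // shift_prepend //.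
  by rewrite init_prepend.
by rewrite shift_prepend // deg_comp // addrC -shift_shift !shift_prepend.
Qed.

Hypothesis hL : row_finite_no_sources L.

(** Append edges of degree [(1, ..., 1)] again and again. *)
Lemma infpath_exists v : exists x, inf_vertex x 0 = v.
Proof.
have /choice[f fP] : forall w, exists a, rng a = w /\ deg a = ones k 1.
  by move=> w; have [[a [ar ad]] _] := hL w (ones k 1); exists a.
pose Q j := iter j (fun a => kcomp a (f (src a))) (kid v).
have fr w : rng (f w) = w by case: (fP w).
have [j|j|x xQ] := @infpath_of_chain Q.
- by exists (f (src (Q j))).
- elim: j => [|j IH] /=.
    by apply/forallP => i; rewrite onesE.
  rewrite deg_comp ?fr // (fP _).2 -addn1 ones_add.
  by rewrite lek_add2r.
exists x; rewrite -(rng_init x 0).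
by rewrite -(path_prefix_rng (xQ 0 0%N (lek0 _))) rng_id.
Qed.

Lemma infpath_extends l : exists x, init x (deg l) = l.
Proof.
have [x xl] := infpath_exists (src l).
by exists (prepend l x); rewrite init_prepend.
Qed.

End Paths.

Arguments init : simpl never.
Arguments inf_vertex : simpl never.
(** * The representation of the Kumjian-Pask algebra on functions of infinite paths *)

Arguments nmul : simpl never.

Section Endomorphisms.
Variables (K : fieldType) (V : lmodType K).

Definition lin_pred : {pred V -> V} := fun f => `[< linear f >].

Fact lin_pred_submod : submod_closed lin_pred.
Proof.
split=> [|c f g /asboolP fl /asboolP gl]; apply/asboolP => a x y.
  by rewrite /= scaler0 addr0.
rewrite [LHS]/(_ + _) /= [in LHS]/(_ *: _) /= fl gl.
by rewrite !scalerDr addrACA !scalerA mulrC.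
Qed.

HB.instance Definition _ :=
  GRing.isSubmodClosed.Build K (V -> V) lin_pred lin_pred_submod.

(** The linear endomorphisms of [V] as a bundled subtype of [V -> V], to have an
    algebra without finiteness conditions on [V]. *)
Record endo := Endo { endo_fun :> V -> V; endoP : endo_fun \in lin_pred }.

HB.instance Definition _ := [isSub for endo_fun].
HB.instance Definition _ := [Choice of endo by <:].
HB.instance Definition _ := [SubChoice_isSubLmodule of endo by <:].

Lemma endo_linear (f : endo) : linear f.
Proof. exact/asboolP/endoP. Qed.

Lemma endo_ext (f g : endo) : (forall x, f x = g x) -> f = g.
Proof. by move=> fg; apply/val_inj/funext. Qed.

Fact endo_comp_subproof (f g : endo) : f \o g \in lin_pred.
Proof. by apply/asboolP => a x y /=; rewrite !endo_linear. Qed.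

Definition endo_comp (f g : endo) : endo := Endo (endo_comp_subproof f g).

Lemma endo_addE (f g : endo) x : (f + g) x = f x + g x.
Proof. by []. Qed.

Fact endo_compA : associative endo_comp.
Proof. by move=> f g h; apply: endo_ext. Qed.
Fact endo_compDl : left_distributive endo_comp +%R.
Proof. by move=> f g h; apply: endo_ext. Qed.
Fact endo_compDr : right_distributive endo_comp +%R.
Proof.
move=> f g h; apply: endo_ext => x.
by have := endo_linear f 1 (g x) (h x); rewrite !scale1r.
Qed.
Fact endo_scaleAl (c : K) f g : c *: endo_comp f g = endo_comp (c *: f) g.
Proof. by apply: endo_ext. Qed.
Fact endo_scaleAr (c : K) f g : c *: endo_comp f g = endo_comp f (c *: g).
Proof.
apply: endo_ext => x.
have f0 : f 0 = 0.
  by have := endo_linear f (-1) 0 0; rewrite scaler0 addr0 scaleN1r addNr.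
by have := endo_linear f c (g x) 0; rewrite !addr0 f0 addr0 => /esym.
Qed.

Definition endo_alg : nualg K :=
  NUAlg endo_compA endo_compDl endo_compDr endo_scaleAl endo_scaleAr.

End Endomorphisms.

Section PartialPullback.
Variables (K : fieldType) (Z : Type).
Local Notation V := (Z -> K^o).
Implicit Types (b : Z -> bool) (h : Z -> Z) (f : V).

Fact pullback_subproof b h :
  (fun f z => if b z then f (h z) else 0) \in @lin_pred K V.
Proof.
apply/asboolP => a f g; apply/funext => z; rewrite !fctE.
by case: ifP => // _; rewrite scaler0 addr0.
Qed.

(** Restrict to [b] and precompose with [h].  All generators act by operators of
    this form, and these are closed under products, so that the Kumjian-Pask
    relations become identities between partial maps. *)
Definition pullback b h : endo_alg V := Endo (pullback_subproof b h).

Lemma pullbackE b h f z : (pullback b h : endo V) f z = if b z then f (h z) else 0.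
Proof. by []. Qed.

Lemma pullback_mul b h b' h' :
  nmul (pullback b h) (pullback b' h') = pullback (fun z => b z && b' (h z)) (h' \o h).
Proof.
apply: endo_ext => f; apply/funext => z /=; by case: (b z).
Qed.

Lemma pullback_eq b h b' h' : b =1 b' -> (forall z, b z -> h z = h' z) ->
  pullback b h = pullback b' h'.
Proof.
move=> bb hh; apply: endo_ext => f; apply/funext => z /=; rewrite -bb.
by case: ifP => // bz; rewrite hh.
Qed.

Lemma pullback0 b h : (forall z, b z = false) -> pullback b h = 0.
Proof. by move=> b0; apply: endo_ext => f; apply/funext => z /=; rewrite b0. Qed.

Lemma pullback_sumE (I : Type) (s : seq I) (B : I -> Z -> bool) (H : I -> Z -> Z) f z :
  (\sum_(i <- s) pullback (B i) (H i) : endo V) f z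
    = \sum_(i <- s) if B i z then f (H i z) else 0.
Proof.
elim: s => [|i s IH]; rewrite ?big_nil // !big_cons.
by rewrite endo_addE /= fctE IH.
Qed.

End PartialPullback.

Lemma teval_tsum (K : fieldType) (k : nat) (L : kgraph k) (A : nualg K)
    (phi : kpgen L -> A) ts :
  teval phi (tsum ts) = \sum_(t <- ts) teval phi t.
Proof. by elim: ts => [|t ts IH] /=; rewrite ?big_nil // big_cons IH. Qed.

(** Functions are acted on instead of linear combinations of infinite paths, so
    that no finiteness has to be maintained.  A path [l] acts by removing [l] from
    the front of an infinite path and its star by prepending [l]; the integer
    records degrees through the additive map [w]. *)
Section PathRepresentation.
Variables (K : fieldType) (k : nat) (L : kgraph k) (w : degree k -> int).
Hypothesis w_add : forall a b : degree k, w (a + b) = w a + w b.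
Local Notation Z := (infpath L * int)%type.
Local Notation V := (Z -> K^o).
Implicit Types (l : kpath L) (v : kvert L).

Definition op_vertex v : endo_alg V :=
  pullback K (fun z : Z => inf_vertex z.1 0 == v) id.

Definition op_path l : endo_alg V :=
  pullback K (fun z : Z => init z.1 (deg l) == l)
        (fun z : Z => (shift (deg l) z.1, z.2 - w (deg l))).

Definition op_star l : endo_alg V :=
  pullback K (fun z : Z => inf_vertex z.1 0 == src l)
        (fun z : Z => (prepend l z.1, z.2 + w (deg l))).

Definition op_gen (g : kpgen L) : endo_alg V :=
  match g with
  | KPv v => op_vertex v
  | KPs l => op_path (val l)
  | KPstar l => op_star (val l)
  end.

Lemma op_path_comp l m : src l = rng m ->
  nmul (op_path l) (op_path m) = op_path (kcomp l m).
Proof.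
move=> lm; rewrite pullback_mul; apply: pullback_eq => -[x g] /=.
  rewrite deg_comp // init_add; apply/andP/eqP => [[/eqP-> /eqP-> //]|e].
  have xl : src (init x (deg l)) = rng (init (shift (deg l) x) (deg m)).
    by rewrite src_init rng_init inf_vertex_shift add0r.
  by have [-> ->] := kcomp_inj xl lm (deg_init _ _) e.
by move=> _; rewrite shift_shift deg_comp // w_add opprD addrA [deg m + _]addrC.
Qed.

Lemma op_star_comp l m : src l = rng m ->
  nmul (op_star m) (op_star l) = op_star (kcomp l m).
Proof.
move=> lm; rewrite pullback_mul; apply: pullback_eq => -[x g] /=.
  rewrite src_comp //; case: eqP => //= xm.
  by rewrite prepend_vertex0 // lm eqxx.
move=> /andP[/eqP xm _].
by rewrite prepend_comp // deg_comp // w_add -addrA [w (deg m) + _]addrC.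
Qed.

Lemma op_star_path l m : deg l = deg m ->
  nmul (op_star l) (op_path m) = if l == m then op_vertex (src l) else 0.
Proof.
move=> dlm; rewrite pullback_mul; have [<-|lm] := eqVneq l m.
  apply: pullback_eq => -[x g] /=.
    by case: eqP => //= xl; rewrite init_prepend // eqxx.
  by move=> /andP[/eqP xl _]; rewrite shift_prepend // addrK.
apply: pullback0 => -[x g] /=; case: eqP => //= xl.
by rewrite -dlm init_prepend // (negPf lm).
Qed.

Lemma op_path_star l :
  nmul (op_path l) (op_star l) = pullback K (fun z : Z => init z.1 (deg l) == l) id.
Proof.
rewrite pullback_mul; apply: pullback_eq => -[x g] /=.
  case: eqP => //= e.
  by rewrite inf_vertex_shift add0r -src_init e eqxx.
by move=> /andP[/eqP e _]; rewrite -{1}e init_shiftK subrK.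
Qed.

Lemma op_gen_rel t u : kp_rel t u -> teval op_gen t = teval op_gen u.
Proof.
case=> [v|v v' vv|l m n ml nlm|l m n ml nlm|l|l|l|l|l|l m lm nlm|v n ls n0 lsu lsP] /=.
- by rewrite pullback_mul; apply: pullback_eq => z //=; rewrite andbb.
- rewrite pullback_mul; apply: pullback0 => z /=.
  by case: eqP => //= ->; exact/eqP.
- by rewrite op_path_comp // nlm.
- by rewrite op_star_comp // nlm.
- rewrite pullback_mul; apply: pullback_eq => z //=.
  by rewrite andbC; case: eqP => //= <-; rewrite rng_init eqxx.
- rewrite pullback_mul; apply: pullback_eq => z //=; case: eqP => //= e.
  by rewrite inf_vertex_shift add0r -src_init e eqxx.
- by rewrite pullback_mul; apply: pullback_eq => z //=; rewrite andbb.
- rewrite pullback_mul; apply: pullback_eq => z //=; case: eqP => //= e.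
  by rewrite prepend_vertex0 // eqxx.
- by rewrite op_star_path // eqxx.
- by rewrite op_star_path //; case: eqP => // /val_inj.
- rewrite teval_tsum big_map.
  under eq_bigr do rewrite /= op_path_star.
  apply: endo_ext => f; apply/funext => z; rewrite pullback_sumE pullbackE.
  case: eqP => xv; last first.
    rewrite big_seq big1 // => l /lsP[lv _]; case: eqP => // e.
    by case: xv; rewrite -lv -(rng_init _ (deg (val l))); congr rng.
  (* Among the paths of degree n from v, only the one that begins z.1 acts. *)
  have ln : deg (init z.1 n) != 0 by rewrite deg_init.
  have lin : (Sub (init z.1 n) ln : nzpath L) \in ls.
    by apply/lsP; rewrite SubK deg_init rng_init xv.
  rewrite (bigD1_seq _ lin lsu) /= deg_init eqxx.
  rewrite big_seq_cond big1 ?addr0 // => l /andP[/lsP[_ ld] ne].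
  by case: eqP => // e; case/eqP: ne; apply: val_inj; rewrite /= -e ld.
Qed.

Lemma path_rep_exists : exists f : KP K L -> endo_alg V,
  nualg_hom f /\ (forall g, f (pgen (@kp_rel K k L) g) = op_gen g).
Proof.
by have [f [fP _]] := presented_universal op_gen_rel; exists f.
Qed.

End PathRepresentation.
(** * Computing in the Kumjian-Pask algebra *)

Section KumjianPaskCalculus.
Variables (K : fieldType) (k : nat) (L : kgraph k).
Local Notation A := (KP K L).
Local Notation rel := (@kp_rel K k L).
Implicit Types (l m : kpath L) (v w : kvert L) (n p : degree k).

Definition vproj v : A := pgen rel (KPv v).

(** The generators for nonzero degree and the vertex idempotents in one family
    indexed by all paths, to avoid treating degree zero apart. *)
Definition spath l : A :=
  if insub l is Some l' then pgen rel (KPs l') else vproj (rng l).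

Definition sstar l : A :=
  if insub l is Some l' then pgen rel (KPstar l') else vproj (rng l).

Lemma nzpathP l : l = kid (rng l) \/ exists l' : nzpath L, l = val l'.
Proof.
have [/deg0_kid|d] := eqVneq (deg l) 0; first by left.
by right; exists (Sub l d); rewrite SubK.
Qed.

Lemma spath_kid v : spath (kid v) = vproj v.
Proof. by rewrite /spath insubN ?rng_id // deg_id eqxx. Qed.

Lemma sstar_kid v : sstar (kid v) = vproj v.
Proof. by rewrite /sstar insubN ?rng_id // deg_id eqxx. Qed.

Lemma spath_val (l : nzpath L) : spath (val l) = pgen rel (KPs l).
Proof. by rewrite /spath valK. Qed.

Lemma sstar_val (l : nzpath L) : sstar (val l) = pgen rel (KPstar l).
Proof. by rewrite /sstar valK. Qed.

Lemma vproj_idem v : nmul (vproj v) (vproj v) = vproj v.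
Proof. exact: (pgen_rel (kp1_idem K v)). Qed.

Lemma vproj_orth v w : v <> w -> nmul (vproj v) (vproj w) = 0.
Proof. by move=> vw; have := pgen_rel (kp1_orth K vw). Qed.

Lemma vproj_spath l : nmul (vproj (rng l)) (spath l) = spath l.
Proof.
case: (nzpathP l) => [->|[l' ->]]; first by rewrite spath_kid rng_id vproj_idem.
by rewrite spath_val; exact: (pgen_rel (kp2_rng K l')).
Qed.

Lemma spath_vproj l : nmul (spath l) (vproj (src l)) = spath l.
Proof.
case: (nzpathP l) => [->|[l' ->]]; first by rewrite spath_kid src_id vproj_idem.
by rewrite spath_val; exact: (pgen_rel (kp2_src K l')).
Qed.

Lemma vproj_sstar l : nmul (vproj (src l)) (sstar l) = sstar l.
Proof.
case: (nzpathP l) => [->|[l' ->]]; first by rewrite sstar_kid src_id vproj_idem.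
by rewrite sstar_val; exact: (pgen_rel (kp2_src_star K l')).
Qed.

Lemma sstar_vproj l : nmul (sstar l) (vproj (rng l)) = sstar l.
Proof.
case: (nzpathP l) => [->|[l' ->]]; first by rewrite sstar_kid rng_id vproj_idem.
by rewrite sstar_val; exact: (pgen_rel (kp2_rng_star K l')).
Qed.

Lemma deg_comp_neq0 l m : src l = rng m -> deg l != 0 -> deg (kcomp l m) != 0.
Proof.
move=> lm; apply: contra => /eqP; rewrite deg_comp // => d0; apply/eqP/ffunP => i.
have /eqP := congr1 (fun d : degree k => d i) d0.
by rewrite addkE ffunE addn_eq0 => /andP[/eqP-> _].
Qed.

Lemma spath_comp l m : src l = rng m ->
  nmul (spath l) (spath m) = spath (kcomp l m).
Proof.
move=> lm; case: (nzpathP l) => [le|[l' le]].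
  have -> : l = kid (rng m) by rewrite -lm le src_id.
  by rewrite spath_kid comp_idl vproj_spath.
case: (nzpathP m) => [me|[m' me]].
  have -> : m = kid (src l) by rewrite lm me rng_id.
  by rewrite spath_kid comp_idr spath_vproj.
have d : deg (kcomp l m) != 0 by apply: deg_comp_neq0; rewrite // le (valP l').
rewrite -[kcomp l m](SubK (nzpath L) d) spath_val {1}le {1}me !spath_val.
by apply: (pgen_rel (@kp2_comp K k L l' m' _ _ _)); rewrite ?SubK -?le -?me.
Qed.

Lemma sstar_comp l m : src l = rng m ->
  nmul (sstar m) (sstar l) = sstar (kcomp l m).
Proof.
move=> lm; case: (nzpathP l) => [le|[l' le]].
  have -> : l = kid (rng m) by rewrite -lm le src_id.
  by rewrite sstar_kid comp_idl sstar_vproj.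
case: (nzpathP m) => [me|[m' me]].
  have -> : m = kid (src l) by rewrite lm me rng_id.
  by rewrite sstar_kid comp_idr vproj_sstar.
have d : deg (kcomp l m) != 0 by apply: deg_comp_neq0; rewrite // le (valP l').
rewrite -[kcomp l m](SubK (nzpath L) d) sstar_val {1}le {1}me !sstar_val.
by apply: (pgen_rel (@kp2_comp_star K k L l' m' _ _ _)); rewrite ?SubK -?le -?me.
Qed.

Lemma sstar_spath l : nmul (sstar l) (spath l) = vproj (src l).
Proof.
case: (nzpathP l) => [->|[l' ->]].
  by rewrite sstar_kid spath_kid src_id vproj_idem.
by rewrite spath_val sstar_val; exact: (pgen_rel (kp3_eq K l')).
Qed.

Lemma sstar_spath0 l m : deg l = deg m -> l <> m -> nmul (sstar l) (spath m) = 0.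
Proof.
move=> d lm; case: (nzpathP l) (nzpathP m) => [le|[l' le]] [me|[m' me]].
- rewrite le me sstar_kid spath_kid vproj_orth // => e.
  by apply: lm; rewrite le me e.
- by case/eqP: (valP m'); rewrite -[LHS]/(deg (val m')) -me -d le deg_id.
- by case/eqP: (valP l'); rewrite -[LHS]/(deg (val l')) -le d me deg_id.
- rewrite le me sstar_val spath_val.
  have lm' : l' <> m' by move=> e; apply: lm; rewrite le me e.
  have d' : deg (val l') = deg (val m') by rewrite -le -me.
  by have := pgen_rel (kp3_neq K d' lm').
Qed.

(** The fourth relation, extended to degree zero. *)
Lemma vproj_sum v n (ls : seq (kpath L)) : uniq ls ->
  (forall l, l \in ls <-> rng l = v /\ deg l = n) ->
  vproj v = \sum_(l <- ls) nmul (spath l) (sstar l).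
Proof.
move=> lsu lsP; have [n0|n0] := eqVneq n 0.
  rewrite (perm_big [:: kid v]) ?big_seq1; last first.
    apply: uniq_perm => // l; rewrite inE; apply/idP/eqP => [/lsP[<-]|->].
      by rewrite n0; exact: deg0_kid.
    by apply/lsP; rewrite rng_id deg_id n0.
  by rewrite spath_kid sstar_kid vproj_idem.
pose ls' : seq (nzpath L) := pmap insub ls.
have lsE : map val ls' = ls.
  rewrite (pmap_filter (@insubK _ _ _)); apply/all_filterP/allP => l /lsP[_ ld].
  by rewrite isSome_insub ld.
have ls'u : uniq ls' by apply: pmap_sub_uniq.
have ls'P (l : nzpath L) : l \in ls' <-> rng (val l) = v /\ deg (val l) = n.
  by rewrite -lsP -lsE mem_map //; exact: val_inj.
have -> : vproj v = _ := pgen_rel (kp4 K n0 ls'u ls'P).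
rewrite teval_tsum big_map -lsE big_map; apply: eq_bigr => l _.
by rewrite spath_val sstar_val.
Qed.

Lemma KP_span (S : set A) :
  (forall x y, S x -> S y -> lin_span S (nmul x y)) ->
  (forall v, lin_span S (vproj v)) ->
  (forall l, lin_span S (spath l)) -> (forall l, lin_span S (sstar l)) ->
  forall a, lin_span S a.
Proof.
move=> SM Sv Ss St; elim/quotW=> t; rewrite -[X in lin_span _ X](teval_pgen rel).
elim: t => /= [[v|l|l]||t IH|t IHt u IHu|c t IH|t IHt u IHu].
- exact: Sv.
- by rewrite -spath_val; exact: Ss.
- by rewrite -sstar_val; exact: St.
- exact: span0.
- by rewrite -scaleN1r; exact: spanZ.
- exact: spanD.
- exact: spanZ.
- exact: spanM.
Qed.

Lemma enum_paths (hL : row_finite_no_sources L) v n : exists ls : seq (kpath L),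
  uniq ls /\ forall l, l \in ls <-> rng l = v /\ deg l = n.
Proof.
have [_ /finite_seqP[s sE]] := hL v n; exists (undup s); split=> [|l].
  exact: undup_uniq.
rewrite mem_undup -[rng l = v /\ _]/(paths_at v n l) sE; by [].
Qed.

Section Representation.
Variables (w : degree k -> int).
Hypothesis w_add : forall a b : degree k, w (a + b) = w a + w b.
Local Notation V := (infpath L * int -> K^o).

Definition path_rep : A -> endo_alg V := sval (cid (path_rep_exists K L w_add)).

Lemma path_rep_hom : nualg_hom path_rep.
Proof. by rewrite /path_rep; case: cid => f []. Qed.

Lemma path_rep_gen g : path_rep (pgen rel g) = op_gen K w g.
Proof. by rewrite /path_rep; case: cid => f []. Qed.

Lemma path_repM a b : path_rep (nmul a b) = nmul (path_rep a) (path_rep b).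
Proof. by case: path_rep_hom => _ ->. Qed.

Lemma path_repB a b : path_rep (a - b) = path_rep a - path_rep b.
Proof.
have [flin _] := path_rep_hom.
by rewrite addrC -scaleN1r flin scaleN1r addrC.
Qed.

Lemma path_rep0 : path_rep 0 = 0.
Proof. by rewrite -(subrr 0) path_repB subrr. Qed.

Lemma w0 : w 0 = 0.
Proof. by apply: (addrI (w 0)); rewrite -w_add !addr0. Qed.

Lemma init0 (x : infpath L) : init x 0 = kid (inf_vertex x 0).
Proof. by rewrite (deg0_kid (deg_init x 0)) rng_init. Qed.

Lemma kid_inj : injective (@kid k L).
Proof. by move=> v v' e; rewrite -(rng_id v) e rng_id. Qed.

Lemma path_rep_vproj v : path_rep (vproj v) = op_vertex K v.
Proof. exact: path_rep_gen. Qed.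

Lemma path_rep_spath l : path_rep (spath l) = op_path K w l.
Proof.
case: (nzpathP l) => [->|[l' ->]]; last by rewrite spath_val path_rep_gen.
rewrite spath_kid path_rep_vproj; apply: pullback_eq => -[x g] /=.
  by rewrite deg_id init0 (inj_eq kid_inj).
by rewrite deg_id w0 shift0 subr0.
Qed.

Lemma path_rep_sstar l : path_rep (sstar l) = op_star K w l.
Proof.
case: (nzpathP l) => [->|[l' ->]]; last by rewrite sstar_val path_rep_gen.
rewrite sstar_kid path_rep_vproj; apply: pullback_eq => -[x g] /=.
  by rewrite src_id.
move=> /eqP xv; rewrite deg_id w0 addr0; congr pair.
have e : src (kid (rng l)) = inf_vertex x 0 by rewrite src_id xv.
by have := shift_prepend e; rewrite deg_id shift0.
Qed.

End Representation.

(** It acts nontrivially on the constant function [1], since some infinite path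
    starts at [v]. *)
Lemma vproj_neq0 (hL : row_finite_no_sources L) v : vproj v <> 0.
Proof.
have w_add : forall m n : degree k, (0 : int) = 0 + 0 by [].
have [x xv] := infpath_exists hL v.
move=> /(congr1 (path_rep w_add)); rewrite path_rep0 path_rep_vproj.
move=> /(congr1 (fun f : endo (infpath L * int -> K^o) => f (fun=> 1) (x, 0))).
rewrite pullbackE /= xv eqxx => e.
by have /eqP : (1 : K) = 0 := e; rewrite oner_eq0.
Qed.

End KumjianPaskCalculus.
(** * Line points from the socle *)

(** If [a] is a sum of elements of finitely many minimal left ideals, then each
    multiple [r = r * a] lies in their sum.  The bound depends on [a] alone. *)
Lemma socle_chain (K : fieldType) (A : nualg K) (a : A) : socle a ->
  exists N, forall J : nat -> set A,
    (forall i, left_ideal (J i)) -> (forall i, J i `<=` J i.+1) ->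
    (forall i r, J i r -> nmul r a = r) ->
  exists2 i, (i <= N)%N & J i = J i.+1.
Proof.
move=> [s sP ->].
have [Ls [LsP sL]] : exists Ls : seq (set A),
    (forall S, S \in Ls -> minimal_left_ideal S) /\ ideal_sum Ls (\sum_(b <- s) b).
  elim: s sP => [|b s IH] sP; first by exists [::]; rewrite big_nil.
  have [b'|Ls [LsP sL]] := IH; first by move=> b's; apply: sP; rewrite in_cons b's orbT.
  have [L Lmin Lb] := sP b (mem_head _ _).
  exists (L :: Ls); split=> [S|]; first by rewrite in_cons => /predU1P[->|/LsP].
  by exists b, (\sum_(b <- s) b); split=> //; rewrite big_cons.
exists (size Ls) => J JI Jinc Ja; apply: chain_stationary => // i r /Ja <-.
have [_ SM] : left_ideal (ideal_sum Ls) by apply: ideal_sum_left => S /LsP[].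
exact: SM.
Qed.

Section SocleToLinePoints.
Variables (k : nat) (L : kgraph k) (hL : row_finite_no_sources L) (K : fieldType).
Implicit Types (l a b c : kpath L) (v w : kvert L) (n p : degree k).
Implicit Types x y z : infpath L.
Local Notation A := (KP K L).
Local Notation vproj := (@vproj K k L).
Local Notation spath := (@spath K k L).
Local Notation sstar := (@sstar K k L).

(** The condition of having one infinite path, expressed with finite paths. *)
Definition thin w : Prop :=
  forall a b, rng a = w -> rng b = w -> deg a = deg b -> a = b.

Lemma thin_infpath w x y : thin w -> inf_vertex x 0 = w -> inf_vertex y 0 = w ->
  x = y.
Proof.
by move=> wt xw yw; apply: init_inj => j; apply: wt; rewrite ?rng_init ?deg_init.
Qed.

Lemma thin_infpaths_at w x : thin w -> inf_vertex x 0 = w ->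
  infpaths_at w = [set x].
Proof.
by move=> wt xw; apply/seteqP; split=> [y yw|_ -> //]; exact: thin_infpath wt yw xw.
Qed.

Lemma infpaths_at_thin w x : infpaths_at w = [set x] -> thin w.
Proof.
move=> wx a b aw bw dab.
have at_w c y : init y (deg c) = c -> rng c = w -> y = x.
  move=> yc cw; have : infpaths_at w y.
    by rewrite /infpaths_at /= -(rng_init _ (deg c)) yc.
  by rewrite wx.
have [y ya] := infpath_extends hL a; have [z zb] := infpath_extends hL b.
by rewrite -ya -zb (at_w a y) // (at_w b z) // dab.
Qed.

Lemma spath_neq0 l : spath l <> 0.
Proof.
move=> l0; have := sstar_spath K l; rewrite l0 nmul0r => /esym.
exact: vproj_neq0.
Qed.

Section Socle.
Hypothesis soc : @socle K A = setT.

(** Given paths [l_0], [l_1], ... from [v] of one degree, the elements of [A p_v]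
    that annihilate all [s_(l_j)] with [j >= i] form a left ideal increasing with
    [i]; the idempotent of [l_i] shows that it increases strictly. *)
Lemma paths_bounded v : exists N, forall n (ls : seq (kpath L)),
  uniq ls -> (forall l, l \in ls -> rng l = v /\ deg l = n) -> (size ls <= N)%N.
Proof.
have [|N NP] := @socle_chain _ A (vproj v); first by rewrite soc.
exists N => n ls lsu lsP; rewrite leqNgt; apply/negP => Nls.
pose l0 := kid v.
pose J i : set A := [set r | nmul r (vproj v) = r /\ forall j, (i <= j)%N ->
  (j < size ls)%N -> nmul r (spath (nth l0 ls j)) = 0].
have [||i r []|i iN] // := NP J.
- move=> i; split; first split.
  + by rewrite /J /= nmul0l; split=> // j; rewrite nmul0l.
  + move=> r s [rv rl] [sv sl]; split; first by rewrite nmulBl rv sv.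
    by move=> j ij jl; rewrite nmulBl rl // sl // subrr.
  + move=> r s [sv sl]; split; first by rewrite -nmulA sv.
    by move=> j ij jl; rewrite -nmulA sl // nmul0r.
- by move=> i r [rv rl]; split=> // j ij; apply: rl; exact: ltnW.
have il : (i < size ls)%N := leq_ltn_trans iN Nls.
have [liv lid] := lsP _ (mem_nth l0 il).
set li := nth l0 ls i in liv lid.
have : J i.+1 (nmul (spath li) (sstar li)).
  split=> [|j ij jl]; first by rewrite -nmulA -liv sstar_vproj.
  have [_ ljd] := lsP _ (mem_nth l0 jl).
  rewrite -nmulA sstar_spath0 ?nmul0r ?lid ?ljd // => /eqP.
  by rewrite nth_uniq // => /eqP e; rewrite e ltnn in ij.
move=> + e; rewrite -e => -[_ /(_ i (leqnn i) il)].
by rewrite -nmulA sstar_spath spath_vproj; exact: spath_neq0.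
Qed.

(** Take [n] for which the number of paths from [v] of degree [n] is largest.
    If two paths of the same degree left the source of one of them, extending all
    of them would produce more paths of a larger degree. *)
Lemma thin_level v : exists n, forall a, rng a = v -> deg a = n -> thin (src a).
Proof.
have [N NP] := paths_bounded v.
pose level (M : nat) := `[< exists n (ls : seq (kpath L)), [/\ uniq ls,
  forall l, l \in ls -> rng l = v /\ deg l = n & size ls = M] >].
have level0 : exists M, level M by exists 0%N; apply/asboolP; exists 0, [::].
have levelN M : level M -> (M <= N)%N by move=> /asboolP[n [ls [u P <-]]]; exact: NP u P.
case: (ex_maxnP level0 levelN) => M /asboolP[n [ls [lsu lsP lsM]]] Mmax.
exists n => a av an.
have als : a \in ls.
  apply: contraT => nals; suff : level M.+1 by move=> /Mmax; rewrite ltnn.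
  apply/asboolP; exists n, (a :: ls); split=> /=; rewrite ?nals ?lsM //.
  by move=> l; rewrite in_cons => /predU1P[->|/lsP].
move=> b c bs cs dbc; apply: contrapT => bc.
have /choice[e eP] : forall l, exists d, rng d = src l /\ deg d = deg b.
  by move=> l; have [[d [dr dd]] _] := hL (src l) (deg b); exists d.
pose f l := if l == a then b else e l.
have fs l : src l = rng (f l).
  by rewrite /f; case: eqP => [->|_] //; have [-> _] := eP l.
have fd l : deg (f l) = deg b by rewrite /f; case: eqP => // _; case: (eP l).
pose ls' := kcomp a c :: [seq kcomp l (f l) | l <- ls].
suff : level M.+1 by move=> /Mmax; rewrite ltnn.
apply/asboolP; exists (n + deg b), ls'; split=> /=; last by rewrite size_map lsM.
- apply/andP; split.
    apply/mapP => -[l /lsP[_ ld]].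
    move=> /(kcomp_inj (esym cs) (fs l))[]; first by rewrite an.
    by move=> <- cf; apply: bc; rewrite cf /f eqxx.
  rewrite map_inj_in_uniq // => l l' /lsP[_ ld] /lsP[_ ld'].
  by move=> /(kcomp_inj (fs l) (fs l'))[] //; rewrite ld.
- move=> l; rewrite in_cons => /predU1P[->|/mapP[l' /lsP[lv ld] ->]].
    by rewrite rng_comp // deg_comp // an dbc.
  by rewrite rng_comp // deg_comp // fd ld lv.
Qed.

(** Suppose [shift p x = shift q x].  On functions supported on [x], the element
    [t0 = s_(x(0,p)) s_(x(0,q))^*] translates the integer by [D], the difference
    of [q] and [p] in a coordinate where they differ.  The left ideals generated by
    [p_v - t0^(2^j)] decrease with [j].  They differ, because a function with
    period [2^(j+1) D] but without period [2^j D] is annihilated by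
    [p_v - t0^(2^(j+1))] and not by [p_v - t0^(2^j)].  Powers of [2] rather than
    powers of [p_v - t0] make this work in every characteristic. *)
Lemma thin_aperiodic x : thin (inf_vertex x 0) -> aperiodic x.
Proof.
set v := inf_vertex x 0 => vt [p [q [pq xpq]]].
have [i pqi] := degree_neq_coord pq.
pose w (d : degree k) : int := (d i)%:Z.
have w_add (m n : degree k) : w (m + n) = w m + w n by rewrite /w addkE.
pose al := init x p; pose be := init x q.
pose D := w q - w p.
have D0 : D != 0 by rewrite subr_eq0; apply/eqP => -[/esym].
pose t0 := nmul (spath al) (sstar be).
pose t (m : nat) : A := iter m (fun r : A => nmul r r) t0.
have t0v : nmul (vproj v) t0 = t0.
  by rewrite nmulA -[v]/(inf_vertex x 0) -(rng_init x p) vproj_spath.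
have tv0 : nmul t0 (vproj v) = t0.
  by rewrite -nmulA -[v]/(inf_vertex x 0) -(rng_init x q) sstar_vproj.
have tv m : nmul (vproj v) (t m) = t m /\ nmul (t m) (vproj v) = t m.
  elim: m => [|m [IHl IHr]] //; split; rewrite /= -/(t m).
    by rewrite nmulA IHl.
  by rewrite -nmulA IHr.
pose act (b : A) (f : infpath L * int -> K^o) : infpath L * int -> K^o :=
  (path_rep w_add b : endo _) f.
have actM (b c : A) f : act (nmul b c) f = act b (act c f) by rewrite /act path_repM.
have actB (b c : A) f (z : infpath L * int) : act (b - c) f z = act b f z - act c f z.
  by rewrite /act path_repB.
have act_v f g : act (vproj v) f (x, g) = f (x, g).
  by rewrite /act path_rep_vproj pullbackE /= eqxx.
have act_t0 f g : act t0 f (x, g) = f (x, g + D).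
  have qp : inf_vertex (shift p x) 0 = src be.
    by rewrite xpq inf_vertex_shift add0r src_init.
  rewrite actM /act path_rep_spath path_rep_sstar !pullbackE /= !deg_init qp !eqxx.
  rewrite xpq init_shiftK.
  by congr (f (x, _)); rewrite /D addrA addrAC.
have act_t m f g : act (t m) f (x, g) = f (x, g + D * (2 ^ m)%N%:Z).
  elim: m f g => [|m IH] f g; first by rewrite act_t0 mulr1.
  by rewrite /= -/(t m) actM !IH expnS mul2n -addnn PoszD mulrDr addrA.
have [|N NP] := @socle_chain _ A (vproj v); first by rewrite soc.
(* Reversed indices turn the decreasing chain into an increasing one, which is
   constant from index N + 1 on; the repetition found at j <= N is before that. *)
pose J j : set A := [set r | exists b : A, r = nmul b (vproj v - t (N.+1 - j)%N)].
have vt' m : nmul (vproj v) (vproj v - t m) = vproj v - t m.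
  by rewrite nmulBr vproj_idem (tv m).1.
have [j|j r [b ->]|j r [b ->]|j jN] := NP J.
- split; first split.
  + by exists 0; rewrite nmul0l.
  + by move=> _ _ [b ->] [c ->]; exists (b - c); rewrite nmulBl.
  + by move=> b _ [c ->]; exists (nmul b c); rewrite nmulA.
- have [jN|Nj] := leqP j N; last first.
    have /eqP E : (N.+1 - j == 0)%N by rewrite subn_eq0.
    have /eqP E' : (N.+1 - j.+1 == 0)%N by rewrite subn_eq0 ltnW.
    by exists b; rewrite E E'.
  (* p_v - t^2 = (p_v + t) (p_v - t) *)
  exists (nmul b (vproj v + t (N - j)%N)).
  rewrite subSS subSn // -nmulA; congr nmul.
  by rewrite nmulDl vt' nmulBr /= (tv _).2 addrA subrK.
- by rewrite -nmulA nmulBl vproj_idem (tv _).2.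
move=> e; have : J j (vproj v - t (N - j)%N).
  by rewrite e; exists (vproj v); rewrite subSS vt'.
rewrite /J subSn //; set m := (N - j)%N => -[b bE].
pose f (z : infpath L * int) : K^o := ((D * (2 ^ m.+1)%N%:Z %| z.2)%Z)%:R.
have f0 : act (vproj v - t m.+1) f = 0.
  apply/funext => -[y g]; rewrite -vt' actM {1}/act path_rep_vproj pullbackE.
  case: eqP => // yv; have -> : y = x := thin_infpath vt yv erefl.
  rewrite -[LHS]/(act (vproj v - t m.+1) f (x, g)).
  by rewrite actB act_v act_t /f /= (rpredDr _ (dvdzz _)) subrr.
have : act (vproj v - t m) f (x, 0) = 0.
  rewrite bE actM f0 /act.
  have := endo_linear (path_rep w_add b) (-1) 0 0.
  by rewrite scaler0 addr0 scaleN1r addNr => ->.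
rewrite actB act_v act_t /f /= add0r dvdz0.
have -> : (D * (2 ^ m.+1)%N %| D * (2 ^ m)%N)%Z = false.
  by rewrite dvdz_mul2l // dvdzE !absz_nat dvdn_Pexp2l // ltnn.
by rewrite subr0 => /eqP; rewrite oner_eq0.
Qed.

End Socle.
End SocleToLinePoints.
(** * Matrix units indexed by tail-equivalent infinite paths *)

(** The two injections give a bijection by the Cantor-Bernstein theorem. *)
Lemma enumerate_infinite (T : Type) (S : set T) (f : T -> nat) (h : nat -> T) :
  {in S &, injective f} -> injective h -> (forall n, S (h n)) ->
  exists e : nat -> T, [/\ injective e, forall n, S (e n)
    & forall y, S y -> exists n, e n = y].
Proof.
move=> finj hinj hS.
have : (S #= [set: nat])%card.
  apply/card_eqPle; split; first by apply/countable_injP; exists f.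
  have hE : (h @` [set: nat] #= [set: nat])%card.
    by apply: inj_card_eq => m n _ _; exact: hinj.
  move: hE; rewrite card_eq_sym card_eq_le => /andP[hE _].
  apply: card_le_trans hE _; apply: subset_card_le => _ [n _ <-]; exact: hS.
move=> /card_set_bijP[g [_ ginj gsurj]].
have /choice[e eP] : forall n, exists y, S y /\ g y = n.
  by move=> n; have [y Sy <-] := gsurj n I; exists y.
exists e; split=> [m n emn|n|y Sy].
- by have [_ <-] := eP m; have [_ <-] := eP n; rewrite emn.
- by have [] := eP n.
- by exists (g y); have [Se ge] := eP (g y); apply: ginj (mem_set Se) (mem_set Sy) ge.
Qed.

Section MatrixUnits.
Variables (k : nat) (hk : (0 < k)%N) (L : kgraph k).
Variables (hL : row_finite_no_sources L) (K : fieldType).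
Implicit Types (l a b c : kpath L) (v w : kvert L) (m n p q : degree k).
Implicit Types x y z : infpath L.
Local Notation A := (KP K L).
Local Notation vproj := (@vproj K k L).
Local Notation spath := (@spath K k L).
Local Notation sstar := (@sstar K k L).
Local Notation line := (@line_points k L).

Definition tail_equiv x y : Prop := exists m n, shift m x = shift n y.

Lemma tail_refl x : tail_equiv x x.
Proof. by exists 0, 0. Qed.

Lemma tail_sym x y : tail_equiv x y -> tail_equiv y x.
Proof. by move=> [m [n e]]; exists n, m. Qed.

Lemma tail_trans x y z : tail_equiv x y -> tail_equiv y z -> tail_equiv x z.
Proof.
move=> [m [n e]] [n' [p e']]; exists (n' + m), (n + p).
by rewrite -!shift_shift e shiftC e'.
Qed.

Lemma tail_shift n x : tail_equiv x (shift n x).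
Proof. by exists n, 0; rewrite shift0. Qed.

Lemma line_thin v : line v -> thin v.
Proof. by move=> [x /(infpaths_at_thin hL)]. Qed.

Lemma line_infpath v x y : line v -> inf_vertex x 0 = v -> inf_vertex y 0 = v ->
  x = y.
Proof. by move=> /line_thin vt; exact: (thin_infpath vt). Qed.

Lemma line_aperiodic v x : line v -> inf_vertex x 0 = v -> aperiodic x.
Proof.
move=> vl xv; have [y vy ya] := vl.
have : infpaths_at v x by [].
by rewrite vy => ->.
Qed.

Lemma shift_periodic n x : periodic x -> periodic (shift n x).
Proof. by move=> [p [q [pq e]]]; exists p, q; split=> //; rewrite shiftC e shiftC. Qed.

Lemma shift_vertex0 n x : inf_vertex (shift n x) 0 = inf_vertex x n.
Proof. by rewrite inf_vertex_shift add0r. Qed.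

Lemma thin_shift n x : thin (inf_vertex x 0) -> thin (inf_vertex x n).
Proof.
move=> xt a b an bn dab.
have sx c : rng c = inf_vertex x n -> src (init x n) = rng c by rewrite src_init.
have e : kcomp (init x n) a = kcomp (init x n) b.
  by apply: xt; rewrite ?rng_comp ?rng_init ?deg_comp ?dab //; exact: sx.
by have [] := kcomp_inj (sx _ an) (sx _ bn) erefl e.
Qed.

Lemma thin_line x : thin (inf_vertex x 0) -> aperiodic x -> line (inf_vertex x 0).
Proof. by move=> xt xa; exists x => //; exact: thin_infpaths_at. Qed.

Lemma shift_aperiodic n x : aperiodic x -> aperiodic (shift n x).
Proof.
move=> xa [p [q [pq e]]]; apply: xa; exists (p + n), (q + n); split.
  by move=> /addIk.
by rewrite -!shift_shift.
Qed.

Lemma line_shift n p x : line (inf_vertex x n) -> line (inf_vertex x (n + p)).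
Proof.
move=> xn; have e := shift_vertex0 n x.
have xa := line_aperiodic xn e.
have xt : thin (inf_vertex (shift n x) 0) by rewrite e; exact: line_thin.
have := thin_line _ (@shift_aperiodic p _ xa).
rewrite shift_vertex0 inf_vertex_shift [p + n]addrC; apply.
by rewrite [n + p]addrC -inf_vertex_shift; exact: thin_shift.
Qed.

(** At a thin vertex the fourth relation has a single summand. *)
Lemma vproj_thin v a : thin v -> rng a = v ->
  vproj v = nmul (spath a) (sstar a).
Proof.
move=> vt av; rewrite (@vproj_sum K k L v (deg a) [:: a]) ?big_seq1 //.
move=> l; rewrite inE; split=> [/eqP->|[lv ld]] //.
by apply/eqP/vt.
Qed.

Definition unit_at m n x y : A := nmul (spath (init x m)) (sstar (init y n)).

(** Insert the idempotent of the line point [x(m)], written as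
    [s_a s_a^*] for the next segment [a], which [x] and [y] share. *)
Lemma unit_at_extend m n p x y : line (inf_vertex x m) -> shift m x = shift n y ->
  unit_at (m + p) (n + p) x y = unit_at m n x y.
Proof.
move=> xl e; rewrite /unit_at !init_add -e.
have sx : src (init x m) = rng (init (shift m x) p).
  by rewrite src_init rng_init shift_vertex0.
have sy : src (init y n) = rng (init (shift m x) p).
  by rewrite src_init rng_init e shift_vertex0.
rewrite -spath_comp // -sstar_comp // -nmulA (nmulA (spath (init _ p))).
rewrite -(vproj_thin (line_thin xl)) -?sx ?src_init //.
by rewrite nmulA -(src_init x m) spath_vproj.
Qed.

Hypothesis eventually_line :
  forall v, exists n, forall a, rng a = v -> deg a = n -> line (src a).

Lemma infpath_line x : exists n, line (inf_vertex x n).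
Proof.
have [n nP] := eventually_line (inf_vertex x 0); exists n.
by rewrite -src_init; apply: nP; rewrite ?rng_init ?deg_init.
Qed.

(** A period of [x] is a period of its shifts, one of which is the infinite path
    of a line point. *)
Lemma infpath_aperiodic x : aperiodic x.
Proof.
have [n xn] := infpath_line x.
by move=> /(shift_periodic n); apply: line_aperiodic xn _; exact: shift_vertex0.
Qed.

Lemma shift_inj x m n : shift m x = shift n x -> m = n.
Proof.
move=> e; apply: contrapT => mn; apply: (infpath_aperiodic (x := x)).
by exists m, n.
Qed.

(** Cut both elements at the common degree [m + m'] of [x].  The two cuts of
    [y] then agree as well, since otherwise [y] would be periodic. *)
Lemma unit_at_unique m n m' n' x y :
  line (inf_vertex x m) -> shift m x = shift n y ->
  line (inf_vertex x m') -> shift m' x = shift n' y ->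
  unit_at m n x y = unit_at m' n' x y.
Proof.
move=> xm e xm' e'; rewrite -(unit_at_extend m' xm e) -(unit_at_extend m xm' e').
have -> : n + m' = n' + m.
  apply: (@shift_inj y); rewrite [n + _]addrC [n' + _]addrC -!shift_shift.
  by rewrite -e -e' shiftC.
by rewrite [m + _]addrC.
Qed.

Lemma tail_line x y : tail_equiv x y -> exists mn : degree k * degree k,
  line (inf_vertex x mn.1) /\ shift mn.1 x = shift mn.2 y.
Proof.
move=> [m [n e]]; have [p xp] := infpath_line x.
exists (p + m, p + n); split=> /=; first exact: line_shift.
by rewrite -!shift_shift e.
Qed.

Definition tail_unit x y : A :=
  if pselect (tail_equiv x y) is left e then
    let mn := sval (cid (tail_line e)) in unit_at mn.1 mn.2 x y
  else 0.

Lemma tail_unitE m n x y : line (inf_vertex x m) -> shift m x = shift n y ->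
  tail_unit x y = unit_at m n x y.
Proof.
move=> xm e; rewrite /tail_unit; case: pselect => [xy|[]]; last by exists m, n.
by case: cid => -[m' n'] /= [xm' e']; exact: unit_at_unique.
Qed.

Lemma line_src m n x y : shift m x = shift n y ->
  inf_vertex x m = inf_vertex y n.
Proof. by move=> e; rewrite -shift_vertex0 e shift_vertex0. Qed.

Lemma tail_unit_neq0 x y : tail_equiv x y -> tail_unit x y <> 0.
Proof.
move=> /tail_line[[m n] /= [xm e]]; rewrite (tail_unitE xm e) => u0.
have := congr1 (fun r => nmul (nmul (sstar (init x m)) r) (spath (init y n))) u0.
rewrite /= nmul0r nmul0l /unit_at nmulA sstar_spath -nmulA sstar_spath.
rewrite !src_init (line_src e) vproj_idem; exact: vproj_neq0.
Qed.

(** Cutting later, the two units can be arranged to be cut at the same degree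
    in the middle. *)
Lemma tail_unit_mul_aux x y y' z : tail_equiv x y -> tail_equiv y' z ->
  exists m n p, [/\ line (inf_vertex y n), shift m x = shift n y, shift n y' = shift p z,
     tail_unit x y = unit_at m n x y & tail_unit y' z = unit_at n p y' z].
Proof.
move=> /tail_line[[m n] /= [xm e]] /tail_line[[n' p] /= [ym e']].
exists (m + n'), (n + n'), (p + n).
have xl : line (inf_vertex x (m + n')) by exact: line_shift.
have es : shift (m + n') x = shift (n + n') y.
  by rewrite [m + _]addrC [n + _]addrC -!shift_shift e.
have es' : shift (n + n') y' = shift (p + n) z.
  by rewrite [p + _]addrC -!shift_shift e'.
split=> //.
- by rewrite -(line_src es).
- exact: tail_unitE.
- by apply: tail_unitE => //; rewrite addrC; exact: line_shift.
Qed.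

Lemma tail_unit_mul x y z : tail_equiv x y -> tail_equiv y z ->
  nmul (tail_unit x y) (tail_unit y z) = tail_unit x z.
Proof.
move=> xy yz; have [m [n [p [yn e e' -> ->]]]] := tail_unit_mul_aux xy yz.
have xm : line (inf_vertex x m) by rewrite (line_src e).
rewrite (tail_unitE (n := p) xm) ?e // /unit_at.
rewrite -nmulA (nmulA (sstar _)) sstar_spath src_init.
by rewrite nmulA -(line_src e) -(src_init x m) spath_vproj.
Qed.

(** Initial segments of [y] and [y'] of the same degree that lead to a line
    point can be equal only if [y = y']. *)
Lemma tail_unit_mul0 x y y' z : tail_equiv x y -> tail_equiv y' z -> y <> y' ->
  nmul (tail_unit x y) (tail_unit y' z) = 0.
Proof.
move=> xy yz ne; have [m [n [p [yn e e' -> ->]]]] := tail_unit_mul_aux xy yz.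
rewrite /unit_at -nmulA (nmulA (sstar _)) sstar_spath0 ?deg_init ?nmul0l ?nmul0r //.
move=> i; apply: ne; apply: (prepend_unique i).
apply: line_infpath yn (shift_vertex0 _ _) _.
by rewrite shift_vertex0 -!src_init i.
Qed.

Lemma spath_sstar_unit a b : src a = src b -> line (src a) ->
  exists x y, tail_equiv x y /\ nmul (spath a) (sstar b) = tail_unit x y.
Proof.
move=> ab al; have [z za] := infpath_exists hL (src a).
have e : shift (deg a) (prepend a z) = shift (deg b) (prepend b z).
  by rewrite !shift_prepend -?ab.
have ia : init (prepend a z) (deg a) = a by rewrite init_prepend.
exists (prepend a z), (prepend b z); split; first by exists (deg a), (deg b).
rewrite (tail_unitE _ e) /unit_at ?ia ?init_prepend -?ab //.
by rewrite -src_init ia.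
Qed.

Definition tail_units : set A :=
  [set t | exists x y, tail_equiv x y /\ t = tail_unit x y].

(** Expanding a generator at a degree where all paths end in line points
    writes it as a sum of products [s_a s_b^*], each of which is a unit. *)
Lemma tail_units_span r : lin_span tail_units r.
Proof.
have Su a b : src a = src b -> line (src a) ->
    lin_span tail_units (nmul (spath a) (sstar b)).
  by move=> ab al; apply: span_mem; exact: spath_sstar_unit.
apply: KP_span => [_ _ [x [y [xy ->]]] [y' [z [yz ->]]]|v|l|l].
- have [e|ne] := pselect (y = y').
    rewrite -e in yz *; rewrite tail_unit_mul //; apply: span_mem.
    by exists x, z; split=> //; exact: tail_trans xy yz.
  by rewrite tail_unit_mul0 //; exact: span0.
- have [n nP] := eventually_line v; have [ls [lsu lsP]] := enum_paths hL v n.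
  rewrite (vproj_sum K lsu lsP); apply: span_sum => l /lsP[lv ld].
  by apply: Su => //; exact: nP.
- have [n nP] := eventually_line (src l).
  have [ls [lsu lsP]] := enum_paths hL (src l) n.
  rewrite -spath_vproj (vproj_sum K lsu lsP) nmul_sumr.
  apply: span_sum => a /lsP[av ad].
  by rewrite nmulA spath_comp //; apply: Su; rewrite src_comp //; exact: nP.
- have [n nP] := eventually_line (src l).
  have [ls [lsu lsP]] := enum_paths hL (src l) n.
  rewrite -vproj_sstar (vproj_sum K lsu lsP) nmul_suml.
  apply: span_sum => a /lsP[av ad].
  by rewrite -nmulA sstar_comp //; apply: Su; rewrite ?src_comp //; exact: nP.
Qed.

(** Two infinite paths that meet in a line point coincide from there on. *)
Lemma line_equivE v w x y : line v -> line w ->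
  inf_vertex x 0 = v -> inf_vertex y 0 = w ->
  line_equiv v w <-> tail_equiv x y.
Proof.
move=> vl wl xv yw; split=> [[x' [y' [vx' wy' [m [n e]]]]]|[m [n e]]].
  have xx : x = x' by have : infpaths_at v x by []; rewrite vx'.
  have yy : y = y' by have : infpaths_at w y by []; rewrite wy'.
  exists m, n; rewrite -xx -yy in e.
  apply: (@line_infpath (inf_vertex x m)); rewrite ?shift_vertex0 //.
  by rewrite -[m]add0r; apply: line_shift; rewrite xv.
exists x, y; split; [| |by exists m, n; exact: line_src].
- by apply: thin_infpaths_at => //; exact: line_thin.
- by apply: thin_infpaths_at => //; exact: line_thin.
Qed.

(** Countable: a path is determined by an initial segment that ends in a line
    point.  Infinite: distinct shifts of an aperiodic path differ, and [0 < k]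
    provides infinitely many degrees. *)
Lemma tail_class_enum x : exists e : nat -> infpath L,
  [/\ injective e, forall i : nat, tail_equiv x (e i)
    & forall y, tail_equiv x y -> exists i : nat, e i = y].
Proof.
have [lv lvP] := choice infpath_line.
apply: (@enumerate_infinite _ [set y | tail_equiv x y]
  (fun y => choice.pickle (init y (lv y))) (fun j => shift (ones k j) x)).
- move=> y z _ _ /(pcan_inj (@choice.pickleK _)) e.
  have d : lv y = lv z by rewrite -(deg_init y (lv y)) e deg_init.
  rewrite -d in e; apply: (prepend_unique e).
  apply: line_infpath (lvP y) (shift_vertex0 _ _) _.
  by rewrite shift_vertex0 -!src_init e.
- move=> i j /shift_inj /ffunP /(_ (Ordinal hk)).
  by rewrite !onesE.
- by move=> j; exact: tail_shift.
Qed.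

Local Notation C := (set_type [set line_class v | v in line]).

Lemma class_rep (c : C) : exists v x, [/\ line v, inf_vertex x 0 = v &
  set_val c = line_class v].
Proof.
have [v vl vc] := set_valP c; have [x vx _] := vl.
by exists v, x; split=> //; have : [set x] x by []; rewrite -vx.
Qed.

Lemma line_class_eq v w x y : line v -> line w ->
  inf_vertex x 0 = v -> inf_vertex y 0 = w -> tail_equiv x y ->
  line_class v = line_class w.
Proof.
move=> vl wl xv yw xy; apply/seteqP; split=> u [ul uv]; split=> //.
  have [z uz _] := ul; have zu : infpaths_at u z by rewrite uz.
  apply/(line_equivE wl ul yw zu); apply: tail_trans (tail_sym xy) _.
  exact/(line_equivE vl ul xv zu).
have [z uz _] := ul; have zu : infpaths_at u z by rewrite uz.
apply/(line_equivE vl ul xv zu); apply: tail_trans xy _.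
exact/(line_equivE wl ul yw zu).
Qed.

Lemma class_units : exists e : C -> nat -> infpath L,
  matrix_units (fun (c : C) i j => tail_unit (e c i) (e c j)).
Proof.
have [v vP] := choice class_rep; have [x xP] := choice vP.
have [e eP] := choice (fun c : C => tail_class_enum (x c)).
have e_tail (c : C) i j : tail_equiv (e c i) (e c j).
  have [_ et _] := eP c; exact: tail_trans (tail_sym (et i)) (et j).
have e_inj (c c' : C) i j : e c i = e c' j -> (c, i) = (c', j).
  move=> eij; have [einj et _] := eP c; have [_ et' _] := eP c'.
  have [vl xv cE] := xP c; have [vl' xv' cE'] := xP c'.
  have xx' : tail_equiv (x c) (x c').
    by apply: tail_trans (et i) _; rewrite eij; exact: tail_sym.
  have cc : c = c'.
    apply: val_inj; rewrite -[LHS]/(set_val c) -[RHS]/(set_val c') cE cE'.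
    exact: line_class_eq vl vl' xv xv' xx'.
  by rewrite -cc in eij *; rewrite (einj _ _ eij).
exists e; split.
- by move=> c i j; exact: tail_unit_neq0.
- by move=> c i j l; exact: tail_unit_mul.
- by move=> c c' i j m l ne; apply: tail_unit_mul0 => // /e_inj.
- move=> r; elim: (tail_units_span r) => [|a s t [y [z [yz ->]]] _ IH].
    exact: span0.
  (* The block of the unit of y and z is the class of any line point on y. *)
  constructor=> //; have [n yn] := infpath_line y.
  have cP : [set line_class v | v in line] (line_class (inf_vertex y n)).
    by exists (inf_vertex y n).
  pose c : C := SigSub (mem_set cP).
  have [vl xv cE] := xP c; have [_ _ esurj] := eP c.
  have xy : tail_equiv (x c) y.
    apply: tail_trans (tail_sym (tail_shift n y)).
    apply/(line_equivE vl yn xv (shift_vertex0 n y)).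
    suff : line_class (v c) (inf_vertex y n) by case.
    rewrite -cE; split=> //.
    apply/(line_equivE yn yn (shift_vertex0 n y) (shift_vertex0 n y)).
    exact: tail_refl.
  have [i <-] := esurj y xy; have [j <-] := esurj z (tail_trans xy yz).
  by exists c, i, j.
Qed.

End MatrixUnits.

Theorem theorem4p10 (k : nat) (hk : (0 < k)%N) (L : kgraph k)
    (hL : row_finite_no_sources L) (K : fieldType) :
  semisimple (KP K L) <->
  nualg_iso (KP K L) (direct_sum (line_quotient L) (mat_infty K)).
Proof.
split=> [[_ soc]|iso].
  have level v : exists n, forall a : kpath L,
      rng a = v -> deg a = n -> line_points (src a).
    have [n nP] := thin_level hL soc v; exists n => a av an.
    have [x xa] := infpath_exists hL (src a).
    have xt : thin (inf_vertex x 0) by rewrite xa; exact: nP.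
    by rewrite -xa; exact: thin_line xt (thin_aperiodic soc xt).
  have [e eM] := class_units hk hL K level.
  exact: matrix_units_dsum eM.
have [u uM] := matrix_units_iso
  (@standard_units K (set_type [set line_class v | v in @line_points k L])) iso.
exact: semisimple_from_units uM.
Qed.
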